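(* Fix the number of machines $m$. For every fixed $\varepsilon>0$, the branch-and-bound algorithm $A^{\text{sim-prof}}_{\varepsilon}$ (described in the context), run on any instance of the uniform machine scheduling problem with $n$ jobs and $m$ machines, returns a schedule whose makespan is at most $(1+\varepsilon)^2$ times the optimal makespan, after processing at most $n\cdot\left(\frac{3n(1+\varepsilon)^2}{\varepsilon}\right)^m$ nodes of the branching tree.
   Context: Uniform machine scheduling: $n$ jobs with processing requirements $p_j$ and $m$ machines with speeds $s_i$; job $j$ on machine $i$ takes $p_{j,i}=p_j/s_i$, assumed to be in $\mathbb N$. A schedule assigns each job to one machine; with overheads $\mathbf t\in\mathbb N^m$, the completion time of machine $i$ is $t_i$ plus the processing times of its jobs, and the makespan is the maximum completion time, to be minimized. For a value $T$ let $S_T=\{(j,i):p_{j,i}\le T\}$ and let $PARTIAL\text{-}LP\text{-}MS_m(\mathbf P,\mathbf t,T)$ be the polyhedron of $(x_{j,i})_{(j,i)\in S_T}$ with $\sum_{i:(j,i)\in S_T}x_{j,i}=1$ for each job $j$, $\sum_{j:(j,i)\in S_T}p_{j,i}x_{j,i}\le T-t_i$ for each machine $i$, $x\ge 0$. A job is fractional in $\mathbf x$ if some $x_{j,i}\notin\{0,1\}$. The profile of a node (partial schedule) $v$ is its overhead vector $\Pi(v)=\mathbf t_v$, i.e. the vector of machine completion times of the jobs fixed at $v$. Two profiles are $\varepsilon$-similar if they differ by at most $\varepsilon/n$ in every coordinate. Algorithm $A^{\text{sim-prof}}_{\varepsilon}$: relabel jobs so $p_1\ge\dots\ge p_n$,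 and divide all processing times by the global fractional optimum of the root (the smallest $T$ for which the root polyhedron is nonempty), so that the optimal makespan $T_{opt}$ satisfies $1\le T_{opt}\le 2$. Each node fixes job–machine pairs along its root path and encodes the instance of the unfixed jobs with the resulting overheads. Processing node $v$: compute a vertex of $PARTIAL\text{-}LP\text{-}MS_m(\mathbf P_v,\mathbf t_v,T)$ for the smallest $T$ for which it is nonempty ($LB(v)$ is this $T$); if the vertex is integral the algorithm stops; otherwise choose such a vertex in which the longest unfixed job is fractional, round it to an integer schedule by assigning the fractional jobs to machines via an injection from fractional jobs to machines with $x_{j,i}>0$, giving $UB(v)$ (the makespan of the resulting schedule). Branch on the longest unfixed job, creating $m$ children (the $i$-th fixes it on machine $i$). A child $u$ is discarded if an already found schedule has makespan smaller than $LB(u)$, or if $\max_i\Pi(u)_i>2(1+\varepsilon)^2$, or if some already generated node at the same depth has a profile $\varepsilon$-similar to $\Pi(u)$. Selection is best-first (smallest $LB$ among active nodes). With $LLB$ the minimum $LB$ of active nodes and $LUB$ the best makespan found, the algorithm terminates when $LUB/LLB\le 1+\varepsilon$ and returns the best schedule found.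
   Formalization: If no optimal LP vertex has the longest unfixed job fractional, the described choice is impossible (e.g. speeds 10,1,1, requirements 300,20,20,20); the computed vertex is then rounded instead. At least one job and one machine are assumed. *)

(* Defs.v *)
From mathcomp Require Import all_boot all_order all_algebra all_fingroup.
From mathcomp Require Import boolp classical_sets reals.

Set Implicit Arguments.
Unset Strict Implicit.
Unset Printing Implicit Defensive.

Import Order.TTheory GRing.Theory Num.Theory.

Local Open Scope classical_set_scope.
Local Open Scope ring_scope.

(* The least element of [A]; the value 0 is junk, taken when there is none. *)
Definition smallest (R : realType) (A : set R) : R := xget 0 (A `&` lbound A).

(* [P j i] is the time that job [j] takes on machine [i]; a schedule maps every
   job to its machine. *)

Definition schedule (m n : nat) := {ffun 'I_n -> 'I_m}.

Definition completion (R : realType) (m n : nat) (P : 'I_n -> 'I_m -> R)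
    (sigma : schedule m n) (i : 'I_m) : R :=
  \sum_(j < n | sigma j == i) P j i.

Definition makespan (R : realType) (m n : nat) (P : 'I_n -> 'I_m -> R)
    (sigma : schedule m n) : R :=
  \big[Num.max/0]_(i < m) completion P sigma i.

Definition opt_makespan (R : realType) (m n : nat) (P : 'I_n -> 'I_m -> R) : R :=
  smallest [set makespan P sigma | sigma in [set: schedule m n]].

(* The polyhedron PARTIAL-LP-MS for the jobs in [J] and the overheads [t].  Only
   the coordinates in S_T are variables; the other entries of the matrix are
   padded with 0. *)
Definition partial_lp (R : realType) (m n : nat) (P : 'I_n -> 'I_m -> R)
    (J : {set 'I_n}) (t : 'I_m -> R) (T : R) : set 'M[R]_(n, m) :=
  [set x | [/\ forall j i, ~~ ((j \in J) && (P j i <= T)) -> x j i = 0,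
               forall j, j \in J -> \sum_(i < m | P j i <= T) x j i = 1,
               forall i, \sum_(j in J | P j i <= T) P j i * x j i <= T - t i &
               forall j i, 0 <= x j i]].

(* The vertices of a polyhedron are its extreme points. *)
Definition vertex (R : realType) (m n : nat) (K : set 'M[R]_(n, m))
    (x : 'M[R]_(n, m)) : Prop :=
  K x /\ forall (y z : 'M[R]_(n, m)) (a : R), K y -> K z -> 0 < a < 1 ->
    x = a *: y + (1 - a) *: z -> y = z.

Definition smallest_feasible (R : realType) (m n : nat) (P : 'I_n -> 'I_m -> R)
    (J : {set 'I_n}) (t : 'I_m -> R) : R :=
  smallest [set T | partial_lp P J t T !=set0].

Definition fractional (R : realType) (m n : nat) (x : 'M[R]_(n, m)) (j : 'I_n) :
  bool := [exists i, (x j i != 0) && (x j i != 1)].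

Definition integral (R : realType) (m n : nat) (x : 'M[R]_(n, m)) : bool :=
  [forall j, ~~ fractional x j].

(* Jobs being labelled by nonincreasing length and the longest unfixed job being
   branched on, a node at depth [k] fixes exactly the jobs 0, ..., k - 1.  It is
   encoded by the sequence of their machines. *)
Definition node (m : nat) := seq 'I_m.

Definition unfixed (m n : nat) (v : node m) : {set 'I_n} :=
  [set j : 'I_n | (size v <= j)%N].

Definition profile (R : realType) (m n : nat) (P : 'I_n -> 'I_m -> R)
    (v : node m) (i : 'I_m) : R :=
  \sum_(j < n | onth v j == Some i) P j i.

Definition LB (R : realType) (m n : nat) (P : 'I_n -> 'I_m -> R)
    (v : node m) : R :=
  smallest_feasible P (unfixed n v) (profile P v).

Definition node_lp (R : realType) (m n : nat) (P : 'I_n -> 'I_m -> R)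
    (v : node m) : set 'M[R]_(n, m) :=
  partial_lp P (unfixed n v) (profile P v) (LB P v).

Definition longest_fractional (R : realType) (m n : nat) (v : node m)
    (x : 'M[R]_(n, m)) : Prop :=
  exists j : 'I_n, j = size v :> nat /\ fractional x j.

(* Given the nonintegral vertex [x0] computed at [v], the vertex [x] to be rounded
   has the longest unfixed job fractional.  No such vertex exists when, for
   instance, the longest job fits within LB(v) on a single machine while other
   jobs have to be split; then [x0] itself is rounded. *)
Definition chosen_vertex (R : realType) (m n : nat) (P : 'I_n -> 'I_m -> R)
    (v : node m) (x0 x : 'M[R]_(n, m)) : Prop :=
  (vertex (node_lp P v) x /\ longest_fractional v x) \/
  ((forall y, vertex (node_lp P v) y -> ~ longest_fractional v y) /\ x = x0).

(* [sigma] rounds [x] and keeps the assignments fixed at [v]. *)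
Definition rounding (R : realType) (m n : nat) (v : node m) (x : 'M[R]_(n, m))
    (sigma : schedule m n) : Prop :=
  [/\ forall j : 'I_n, (j < size v)%N -> onth v j = Some (sigma j),
      forall j, j \in unfixed n v -> ~~ fractional x j -> x j (sigma j) = 1,
      forall j, fractional x j -> 0 < x j (sigma j) &
      {in fractional x &, injective sigma}].

Definition similar_profiles (R : realType) (m n : nat) (P : 'I_n -> 'I_m -> R)
    (eps : R) (u v : node m) : Prop :=
  forall i, `|profile P u i - profile P v i| <= eps / n%:R.

(* [generated] lists all the nodes put in the tree so far, processed or not; a
   discarded child never enters it.  [stopped] is set once the computed vertex is
   integral. *)
Record state (m n : nat) := State {
  active : seq (node m);
  generated : seq (node m);
  found : seq (schedule m n);
  stopped : bool }.

Definition initial_state (m n : nat) : state m n :=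
  State [:: [::]] [:: [::]] [::] false.

Definition discarded (R : realType) (m n : nat) (P : 'I_n -> 'I_m -> R)
    (eps : R) (st : state m n) (u : node m) : Prop :=
  [\/ exists2 sigma, sigma \in found st & makespan P sigma < LB P u,
      2 * (1 + eps) ^+ 2 < \big[Num.max/0]_(i < m) profile P u i |
      exists2 w, w \in generated st &
        size w = size u /\ similar_profiles P eps w u].

Definition insert_child (R : realType) (m n : nat) (P : 'I_n -> 'I_m -> R)
    (eps : R) (st : state m n) (u : node m) : state m n :=
  if `[< discarded P eps st u >] then st
  else State (u :: active st) (u :: generated st) (found st) (stopped st).

Definition branch (R : realType) (m n : nat) (P : 'I_n -> 'I_m -> R)
    (eps : R) (st : state m n) (v : node m) : state m n :=
  foldl (insert_child P eps) st [seq rcons v i | i <- enum 'I_m].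

(* An active node whose lower bound is LLB. *)
Definition lowest_active (R : realType) (m n : nat) (P : 'I_n -> 'I_m -> R)
    (st : state m n) (v : node m) : Prop :=
  v \in active st /\ forall u, u \in active st -> LB P v <= LB P u.

(* A schedule found whose makespan is LUB. *)
Definition best_found (R : realType) (m n : nat) (P : 'I_n -> 'I_m -> R)
    (st : state m n) (sigma : schedule m n) : Prop :=
  sigma \in found st /\
  forall tau, tau \in found st -> makespan P sigma <= makespan P tau.

(* Without active nodes LLB is infinite. *)
Definition terminated (R : realType) (m n : nat) (P : 'I_n -> 'I_m -> R)
    (eps : R) (st : state m n) : Prop :=
  [\/ stopped st, active st = [::] |
      exists sigma v, [/\ best_found P st sigma, lowest_active P st v &
                          makespan P sigma / LB P v <= 1 + eps]].

(* The processing of one node.  The vertex, the rounding and the tie-breaking in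
   the best-first selection are arbitrary. *)
Inductive step (R : realType) (m n : nat) (P : 'I_n -> 'I_m -> R) (eps : R)
    (st : state m n) : state m n -> Prop :=
| step_integral v x0 sigma :
    ~ terminated P eps st -> lowest_active P st v ->
    vertex (node_lp P v) x0 -> integral x0 -> rounding v x0 sigma ->
    step P eps st
      (State (rem v (active st)) (generated st) (sigma :: found st) true)
| step_branch v x0 x sigma :
    ~ terminated P eps st -> lowest_active P st v ->
    vertex (node_lp P v) x0 -> ~~ integral x0 ->
    chosen_vertex P v x0 x -> rounding v x sigma ->
    step P eps st
      (branch P eps (State (rem v (active st)) (generated st)
                           (sigma :: found st) (stopped st)) v).

(* [run P eps k st]: the algorithm can be in state [st] after having processed
   [k] nodes. *)
Inductive run (R : realType) (m n : nat) (P : 'I_n -> 'I_m -> R) (eps : R) :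
    nat -> state m n -> Prop :=
| run_init : run P eps 0 (initial_state m n)
| run_step k st st' :
    run P eps k st -> step P eps st st' -> run P eps k.+1 st'.

Definition returns (R : realType) (m n : nat) (P : 'I_n -> 'I_m -> R) (eps : R)
    (st : state m n) (sigma : schedule m n) : Prop :=
  terminated P eps st /\ best_found P st sigma.

Definition times (R : realType) (m n : nat) (p : 'I_n -> R) (s : 'I_m -> R)
    (j : 'I_n) (i : 'I_m) : R := p j / s i.

(* [lab k] is the original name of the job relabelled [k]. *)
Definition relabelled_times (R : realType) (m n : nat) (p : 'I_n -> R)
    (s : 'I_m -> R) (lab : 'S_n) : 'I_n -> 'I_m -> R :=
  fun k i => times p s (lab k) i.

Definition original_labels (m n : nat) (lab : 'S_n) (sigma : schedule m n) :
  schedule m n := [ffun j => sigma ((lab^-1)%g j)].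

Definition normalized (R : realType) (m n : nat) (P : 'I_n -> 'I_m -> R) :
    'I_n -> 'I_m -> R :=
  fun j i => P j i / LB P [::].

(* Main.v *)
Require Import Defs.
From mathcomp Require Import all_boot all_order all_algebra all_fingroup.
From mathcomp Require Import boolp classical_sets reals.
From mathcomp Require Import lra.

(* Quality: fix an optimal schedule [sigma] and call a node [w] promising if
   completing [w] with the machines of [sigma] costs at most
   [opt + size w * eps / n]. The root is promising, and when a promising node is
   processed, its child following [sigma] is kept, or a similar node (again
   promising) is already there, or a schedule of makespan at most
   [(1 + eps) * opt] is known; the bound [2 * (1 + eps) ^ 2] on profiles does not
   interfere because the rounding at the root gives [opt <= 2]. Hence, until such a
   schedule is found, a promising node is active and the smallest active bound is
   at most [(1 + eps) * opt].

   Number of nodes: the generated nodes of one depth have pairwise dissimilar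
   profiles in [0, 2 * (1 + eps) ^ 2]^m, so distinct ones lie in distinct cells of
   a grid of mesh [eps / n]. At most one node of depth [n] is processed, since its
   vertex is integral.

   Progress: the optima and vertices of the linear programs come from points where
   the tight constraints determine the solution; the rounding comes from a nonzero
   term of the determinant of the equations restricted to the fractional edges. *)

Set Implicit Arguments.
Unset Strict Implicit.
Unset Printing Implicit Defensive.

Import Defs.
Import Order.TTheory GRing.Theory Num.Theory.
Local Open Scope ring_scope.

(** * Basic points of polyhedra *)

(** Each index names at most one value, and every element of [A] dominates a named element of [A].
    The least of these finitely many values is then the minimum, so no topological argument is
    needed. *)
Lemma ex_minimum_of_finite_lower_family (R : realFieldType) (I : finType)
    (A : R -> Prop) (r : I -> R -> Prop) :
  (exists a, A a) -> (forall i a b, r i a -> r i b -> a = b) ->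
  (forall a, A a -> exists i b, [/\ A b, r i b & b <= a]) ->
  exists c, A c /\ forall a, A a -> c <= a.
Proof.
move=> [a0 Aa0] r_fun lower.
pose good i := `[< exists b, A b /\ r i b >].
have /choice [val valP] i : exists b, good i -> A b /\ r i b.
  case: (asboolP (exists b, A b /\ r i b)) => [[b Hb] | no]; first by exists b.
  by exists 0 => /asboolP.
have [i0 [b0 [Ab0 rb0 _]]] := lower _ Aa0.
have gi0 : good i0 by apply/asboolP; exists b0.
case: (@arg_minP _ _ _ i0 good val gi0) => i gi val_min.
have [Av rv] := valP _ gi; exists (val i); split=> // a /lower [j [b [Ab rjb le_ba]]].
have gj : good j by apply/asboolP; exists b.
have [_ rvj] := valP _ gj.
by apply: le_trans le_ba; rewrite (r_fun _ _ _ rjb rvj) val_min.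
Qed.

(** The algebraic form of a vertex of the polyhedron [b k <= l k z]: the tight forms have trivial
    common kernel. Feasibility of [z] is stated separately. *)
Definition basic_point (R : realFieldType) (V : lmodType R) (K : finType)
    (l : K -> V -> R) (b : K -> R) (z : V) : Prop :=
  forall d, (forall k, l k z = b k -> l k d = 0) -> d = 0.

(* Moving from [z] along a direction that keeps the tight constraints tight and
   does not increase [f], until a new constraint becomes tight. *)
Lemma ex_basic_point (R : realFieldType) (V : lmodType R) (K : finType)
    (l : K -> V -> R) (b : K -> R) (f : V -> R)
    (l_lin : forall k, scalar (l k)) (f_lin : scalar f)
    (bounded : forall d, f d <= 0 -> (forall k, 0 <= l k d) -> d = 0) (z : V) :
  (forall k, b k <= l k z) ->
  exists z', [/\ forall k, b k <= l k z', f z' <= f z & basic_point l b z'].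
Proof.
have lN (g : V -> R) (g_lin : scalar g) d : g (- d) = - g d.
  have g0 : g 0 = 0.
    by have := g_lin 1 0 0; rewrite scale1r mul1r addr0 -[LHS]addr0 => /addrI.
  by have := g_lin (-1) d 0; rewrite scaleN1r addr0 g0 addr0 mulN1r.
(* Induction on the number of constraints that are not tight. *)
have [N] := ubnP #|[pred k | l k z != b k]|.
elim: N z => // N IHN z; rewrite ltnS => leN feas.
have [basic|] := pselect (basic_point l b z); first by exists z.
move=> /existsNP [d0 /not_implyP [tight0 /eqP d0_neq0]].
have [d [d_neq0 tight fd]] : exists d,
    [/\ d != 0, forall k, l k z = b k -> l k d = 0 & f d <= 0].
  have [fd|fd] := lerP (f d0) 0; first by exists d0.
  exists (- d0); split; rewrite ?oppr_eq0 ?lN // ?oppr_le0 ?ltW //.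
  by move=> k /tight0 eq0; rewrite lN // eq0 oppr0.
have [k0 lk0] : exists k, l k d < 0.
  apply: contrapT => no; case/eqP: d_neq0; apply: bounded => // k.
  by rewrite leNgt; apply/negP => lt0; apply: no; exists k.
(* The step length at which the decreasing constraint [k] becomes tight. The least ratio preserves
   feasibility and makes [k1] tight. *)
pose ratio k := (l k z - b k) / - l k d.
case: (@arg_minP _ _ _ k0 (fun k => l k d < 0) ratio lk0) => k1 lk1 ratio_min.
have r_ge0 : 0 <= ratio k1 by rewrite divr_ge0 ?subr_ge0 // oppr_ge0 ltW.
pose z1 := ratio k1 *: d + z.
have lz1 k : l k z1 = ratio k1 * l k d + l k z by rewrite l_lin.
have [||z' [feas' fz' basic']] := IHN z1.
- apply: leq_trans leN; apply: proper_card; apply/properP; split.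
    apply/fintype.subsetP=> k; rewrite !inE; apply: contra => /eqP tk.
    by rewrite lz1 (tight _ tk) mulr0 add0r tk.
  exists k1; rewrite !inE.
    by apply/negP => /eqP /tight lk10; rewrite lk10 ltxx in lk1.
  rewrite lz1 /ratio invrN mulrN mulNr divfK ?(lt_eqF lk1) //.
  by rewrite opprB subrK eqxx.
- move=> k; rewrite lz1; have [ge0|lt0] := lerP 0 (l k d).
    by apply: le_trans (feas k) _; rewrite lerDr mulr_ge0.
  have := ratio_min _ lt0; rewrite /(ratio k) ler_pdivlMr ?oppr_gt0 //.
  by rewrite mulrN lerNl opprB lerBlDr.
exists z'; split=> //; apply: le_trans fz' _.
by rewrite f_lin gerDr mulr_ge0_le0.
Qed.

(** The tight forms vanish on the difference [w - z]. Basic points are thus named by their tight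
    sets, of which there are finitely many. *)
Lemma basic_point_tight_inj (R : realFieldType) (V : lmodType R) (K : finType)
    (l : K -> V -> R) (b : K -> R) (l_lin : forall k, scalar (l k)) (z w : V) :
  basic_point l b z -> (forall k, (l k z == b k) = (l k w == b k)) -> z = w.
Proof.
move=> basic eq_tight; apply/esym/subr0_eq; apply: basic => k tk.
have /eqP tw : l k w == b k by rewrite -eq_tight tk.
by rewrite -scaleN1r addrC l_lin tk tw mulN1r addNr.
Qed.

(** Where [z] is tight, a convex combination with positive weights of the nonnegative slacks of [y]
    and [w] is zero. Both are tight there too, and the tight forms vanish on [y - w]. *)
Lemma basic_point_extreme (R : realFieldType) (V : lmodType R) (K : finType)
    (l : K -> V -> R) (b : K -> R) (l_lin : forall k, scalar (l k))
    (z y w : V) (a : R) :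
  basic_point l b z -> (forall k, b k <= l k y) -> (forall k, b k <= l k w) ->
  0 < a < 1 -> z = a *: y + (1 - a) *: w -> y = w.
Proof.
move=> basic feas_y feas_w /andP [a_gt0 a_lt1] defz.
have a'_gt0 : 0 < 1 - a by rewrite subr_gt0.
apply: subr0_eq; apply: basic => k.
have lw : l k ((1 - a) *: w) = (1 - a) * l k w.
  have l0 : l k 0 = 0.
    by have := l_lin k 1 0 0; rewrite scale1r mul1r addr0 -[LHS]addr0 => /addrI.
  by have := l_lin k (1 - a) w 0; rewrite addr0 l0 addr0.
rewrite defz l_lin lw [y - w]addrC -scaleN1r l_lin mulN1r => tight.
have : a * (l k y - b k) + (1 - a) * (l k w - b k) = 0.
  rewrite !mulrBr addrACA tight -opprD -mulrDl [a + _]addrC subrK mul1r.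
  by rewrite subrr.
move/eqP; rewrite paddr_eq0 ?mulr_ge0 ?subr_ge0 ?(ltW a_gt0) ?(ltW a_lt1) //.
rewrite !mulf_eq0 (gt_eqF a_gt0) (gt_eqF a'_gt0) /= !subr_eq0.
by move=> /andP [/eqP -> /eqP ->]; rewrite addNr.
Qed.

(** * The linear program of a node *)

Lemma partial_lpE (R : realType) (m n : nat) (P : 'I_n -> 'I_m -> R)
    (J : {set 'I_n}) (t : 'I_m -> R) (T : R) (x : 'M[R]_(n, m)) :
  partial_lp P J t T x <->
  [/\ forall j i, ~~ ((j \in J) && (P j i <= T)) -> x j i = 0,
      forall j, j \in J -> \sum_i x j i = 1,
      forall i, \sum_j P j i * x j i <= T - t i &
      forall j i, 0 <= x j i].
Proof.
have sumT : (forall j i, ~~ ((j \in J) && (P j i <= T)) -> x j i = 0) ->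
    (forall j, j \in J -> \sum_(i < m | P j i <= T) x j i = \sum_i x j i) /\
    (forall i, \sum_(j in J | P j i <= T) P j i * x j i = \sum_j P j i * x j i).
  move=> supp; split=> [j Jj | i]; rewrite big_mkcond; apply: eq_bigr => ? _.
    by case: ifP => // /negbT le; rewrite supp // Jj.
  by case: ifP => // /negbT /supp ->; rewrite mulr0.
split=> [] [supp row load pos]; have [rowE loadE] := sumT supp; split=> //.
- by move=> j Jj; rewrite -rowE ?row.
- by move=> i; rewrite -loadE.
- by move=> j Jj; rewrite rowE ?row.
- by move=> i; rewrite loadE.
Qed.

(** The blocks are, in order: nonnegativity, vanishing outside [S], the two halves of each job
    equation, the machine loads, and the thresholds [P j i <= T] on [S]. *)
Definition lp_index (m n : nat) : finType :=
  ('I_n * 'I_m + 'I_n * 'I_m + ('I_n + 'I_n) + 'I_m + 'I_n * 'I_m)%type.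

(* The value [T] is a coordinate here, so that minimizing it is a linear program
   once the set [S] of variables is frozen. Equations are pairs of inequalities. *)
Definition lp_form (R : realType) (m n : nat) (P : 'I_n -> 'I_m -> R)
    (J : {set 'I_n}) (S : {set 'I_n * 'I_m}) (k : lp_index m n)
    (z : 'M[R]_(n, m) * R^o) : R :=
  match k with
  | inl (inl (inl (inl (j, i)))) => z.1 j i
  | inl (inl (inl (inr (j, i)))) => if (j, i) \in S then 0 else - z.1 j i
  | inl (inl (inr (inl j))) => if j \in J then \sum_i z.1 j i else 0
  | inl (inl (inr (inr j))) => if j \in J then - \sum_i z.1 j i else 0
  | inl (inr i) => z.2 - \sum_j P j i * z.1 j i
  | inr (j, i) => if (j, i) \in S then z.2 else 0
  end.

Definition lp_bound (R : realType) (m n : nat) (P : 'I_n -> 'I_m -> R)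
    (J : {set 'I_n}) (S : {set 'I_n * 'I_m}) (t : 'I_m -> R)
    (k : lp_index m n) : R :=
  match k with
  | inl (inl (inl _)) => 0
  | inl (inl (inr (inl j))) => if j \in J then 1 else 0
  | inl (inl (inr (inr j))) => if j \in J then - 1 else 0
  | inl (inr i) => t i
  | inr (j, i) => if (j, i) \in S then P j i else 0
  end.

Lemma lp_form_linear (R : realType) (m n : nat) (P : 'I_n -> 'I_m -> R)
    (J : {set 'I_n}) (S : {set 'I_n * 'I_m}) (k : lp_index m n) :
  scalar (lp_form P J S k).
Proof.
have sumE (a : R) (x y : 'M[R]_(n, m)) j :
    \sum_i (a *: x + y) j i = a * \sum_i x j i + \sum_i y j i.
  by rewrite mulr_sumr -big_split; apply: eq_bigr => i _; rewrite !mxE.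
have loadE (a : R) (x y : 'M[R]_(n, m)) i :
    \sum_j P j i * (a *: x + y) j i =
      a * (\sum_j P j i * x j i) + \sum_j P j i * y j i.
  rewrite mulr_sumr -big_split; apply: eq_bigr => j _.
  by rewrite !mxE mulrDr mulrCA.
move=> a [x T] [y T']; case: k => [[[[[j i]|[j i]]|[j|j]]|i]|[j i]] /=.
- by rewrite !mxE.
- by case: ifP; rewrite ?mulr0 ?addr0 // !mxE opprD mulrN.
- by case: ifP; rewrite ?mulr0 ?addr0.
- by case: ifP; rewrite ?mulr0 ?addr0 // sumE opprD mulrN.
- by rewrite loadE mulrBr opprD addrACA.
- by case: ifP; rewrite ?mulr0 ?addr0.
Qed.

Lemma lp_feasibleP (R : realType) (m n : nat) (P : 'I_n -> 'I_m -> R)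
    (J : {set 'I_n}) (S : {set 'I_n * 'I_m}) (t : 'I_m -> R)
    (x : 'M[R]_(n, m)) (T : R) :
  (forall k, lp_bound P J S t k <= lp_form P J S k (x, T)) <->
  [/\ forall j i, (j, i) \notin S -> x j i = 0,
      forall j, j \in J -> \sum_i x j i = 1,
      forall i, \sum_j P j i * x j i <= T - t i,
      forall j i, 0 <= x j i &
      forall j i, (j, i) \in S -> P j i <= T].
Proof.
split=> [feas | [supp row load pos fit]].
  have pos j i : 0 <= x j i by exact: (feas (inl (inl (inl (inl (j, i)))))).
  split=> [j i SNji | j Jj | i | // | j i Sji].
  - have := feas (inl (inl (inl (inr (j, i))))); rewrite /= (negPf SNji) oppr_ge0.
    by move=> le0; apply/eqP; rewrite eq_le le0 pos.
  - have := feas (inl (inl (inr (inl j)))); have := feas (inl (inl (inr (inr j)))).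
    by rewrite /= Jj lerN2 => le1 ge1; apply/eqP; rewrite eq_le le1.
  - by have := feas (inl (inr i)); rewrite /= !lerBrDr addrC.
  - by have := feas (inr (j, i)); rewrite /= Sji.
case=> [[[[[j i]|[j i]]|[j|j]]|i]|[j i]] /=.
- exact: pos.
- by case: ifPn => // /supp ->; rewrite oppr0.
- by case: ifP => // /row ->.
- by case: ifP => // /row ->.
- by have := load i; rewrite !lerBrDr addrC.
- by case: ifP => // /fit.
Qed.

(** A recession direction has nonnegative entries with nonpositive row sums, so its matrix part is
    zero; the load constraint of any machine then forces its last coordinate to be nonnegative. This
    is the hypothesis [bounded] of [ex_basic_point] with [T] as objective. *)
Lemma lp_bounded (R : realType) (m n : nat) (P : 'I_n -> 'I_m -> R)
    (J : {set 'I_n}) (S : {set 'I_n * 'I_m}) (d : 'M[R]_(n, m) * R^o) :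
  (0 < m)%N -> {in S, forall ji, ji.1 \in J} -> d.2 <= 0 ->
  (forall k, 0 <= lp_form P J S k d) -> d = 0.
Proof.
case: d => d tau m_gt0 SJ /= tau_le0 rec.
have pos j i : 0 <= d j i by exact: (rec (inl (inl (inl (inl (j, i)))))).
have d0 : d = 0.
  apply/matrixP=> j i; rewrite mxE.
  have [Sji|SNji] := boolP ((j, i) \in S).
    have := rec (inl (inl (inr (inr j)))); rewrite /= (SJ _ Sji) oppr_ge0.
    rewrite (bigD1 i) //= => le0; apply/eqP; rewrite eq_le pos andbT.
    by apply: le_trans le0; rewrite lerDl sumr_ge0.
  have := rec (inl (inl (inl (inr (j, i))))); rewrite /= (negPf SNji) oppr_ge0.
  by move=> le0; apply/eqP; rewrite eq_le le0 pos.
have := rec (inl (inr (Ordinal m_gt0))); rewrite /= big1 => [|j _]; last first.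
  by rewrite d0 mxE mulr0.
by rewrite subr0 => tau_ge0; congr (_, _) => //; apply/eqP; rewrite eq_le tau_le0.
Qed.

Definition lp_support (R : realType) (m n : nat) (P : 'I_n -> 'I_m -> R)
    (J : {set 'I_n}) (T : R) : {set 'I_n * 'I_m} :=
  finset (fun ji => (ji.1 \in J) && (P ji.1 ji.2 <= T)).

Lemma partial_lp_feasible (R : realType) (m n : nat) (P : 'I_n -> 'I_m -> R)
    (J : {set 'I_n}) (t : 'I_m -> R) (T : R) (x : 'M[R]_(n, m)) :
  let S := lp_support P J T in
  partial_lp P J t T x <->
  forall k, lp_bound P J S t k <= lp_form P J S k (x, T).
Proof.
move=> S; rewrite partial_lpE lp_feasibleP; split=> [] [supp row load pos].
  by split=> // j i; rewrite inE /=; [exact: supp | case/andP].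
by move=> _; split=> // j i nji; apply: supp; rewrite inE.
Qed.

(** The thresholds on [S] keep all its pairs inside the support at [T], so a point found with [S]
    frozen stays in the original polyhedron after [T] has decreased. *)
Lemma feasible_partial_lp (R : realType) (m n : nat) (P : 'I_n -> 'I_m -> R)
    (J : {set 'I_n}) (S : {set 'I_n * 'I_m}) (t : 'I_m -> R) (T : R)
    (x : 'M[R]_(n, m)) :
  {in S, forall ji, ji.1 \in J} ->
  (forall k, lp_bound P J S t k <= lp_form P J S k (x, T)) ->
  partial_lp P J t T x.
Proof.
move=> SJ /lp_feasibleP [supp row load pos fit]; apply/partial_lpE; split=> //.
move=> j i; apply: contraNeq => x_neq0.
have Sji : (j, i) \in S by apply: contra_neqT x_neq0 => /supp.
by rewrite (SJ _ Sji) fit.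
Qed.

Lemma partial_lp_nonempty (R : realType) (m n : nat) (P : 'I_n -> 'I_m -> R)
    (J : {set 'I_n}) (t : 'I_m -> R) :
  (0 < m)%N -> exists T x, partial_lp P J t T x.
Proof.
move=> m_gt0; pose i0 := Ordinal m_gt0.
pose load i := \sum_j P j i * ((j \in J) && (i == i0))%:R.
(* All jobs of [J] go to [i0]. This [T] dominates each time on [i0] and each resulting load,
   whatever the signs of the data. *)
pose T := \sum_j `|P j i0| + \sum_i `|t i + load i|.
exists T, (\matrix_(j, i) ((j \in J) && (i == i0))%:R); apply/partial_lpE.
have T1 j : P j i0 <= T.
  apply: le_trans (ler_norm _) _; rewrite /T (bigD1 j) //= -addrA lerDl.
  by rewrite addr_ge0 ?sumr_ge0.
have T2 i : t i + load i <= T.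
  apply: le_trans (ler_norm _) _; rewrite /T (bigD1 i) //= addrCA lerDl.
  by rewrite addr_ge0 ?sumr_ge0.
split=> [j i | j Jj | i | j i].
- by rewrite mxE; case: eqP => [->|]; rewrite ?andbF // T1 !andbT => /negPf ->.
- rewrite (bigD1 i0) //= big1 ?mxE ?Jj ?eqxx ?addr0 // => i /negPf ni.
  by rewrite mxE ni andbF.
- rewrite lerBrDl; apply: le_trans (T2 i); rewrite lerD2l /load le_eqVlt.
  by apply/orP; left; apply/eqP; apply: eq_bigr => j _; rewrite mxE.
- by rewrite mxE ler0n.
Qed.

(** From any feasible point, freezing the support and minimizing leads to a basic point with no
    larger [T]. Its [T] is determined by the support and the tight set, so only finitely many values
    compete and the minimum is attained. *)
Lemma ex_smallest_vertex (R : realType) (m n : nat) (P : 'I_n -> 'I_m -> R)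
    (J : {set 'I_n}) (t : 'I_m -> R) :
  (0 < m)%N ->
  exists T, (forall T' y, partial_lp P J t T' y -> T <= T') /\
            exists x, vertex (partial_lp P J t T) x.
Proof.
move=> m_gt0.
have suppJ T : {in lp_support P J T, forall ji, ji.1 \in J}.
  by move=> ji; rewrite inE => /andP [].
pose l S := lp_form P J S; pose b S := lp_bound P J S t.
have improve T y : partial_lp P J t T y ->
    let S := lp_support P J T in exists x T', [/\ partial_lp P J t T' x, T' <= T,
      forall k, b S k <= l S k (x, T') & basic_point (l S) (b S) (x, T')].
  move=> /partial_lp_feasible feas S.
  have [|||[x T'] [feas' le_T' basic]] :=
    @ex_basic_point _ _ _ (l S) (b S) (fun z => z.2) _ _ _ (y, T) feas.
  - exact: lp_form_linear.
  - by move=> a z w.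
  - move=> d; apply: lp_bounded => //; exact: suppJ.
  by exists x, T'; split=> //; apply: feasible_partial_lp (feas'); exact: suppJ.
pose tight (i : {set 'I_n * 'I_m} * {set lp_index m n}) T := exists x : 'M[R]_(n, m),
  basic_point (l i.1) (b i.1) (x, T) /\
  i.2 = finset (fun k => l i.1 k (x, T) == b i.1 k).
have [||T0 [T0x]|T [[x0 lpx0] T_min]] := @ex_minimum_of_finite_lower_family R _
    (fun T => exists x, partial_lp P J t T x) tight.
- exact: partial_lp_nonempty.
- move=> [S A] T1 T2 [x1 [/= basic1 A1]] [x2 [/= _ A2]].
  suff [] : (x1, T1 : R^o) = (x2, T2) by [].
  apply: basic_point_tight_inj basic1 _ => [|k]; first exact: lp_form_linear.
  by move/setP/(_ k): A1; rewrite A2 !inE.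
- move=> /improve [y [T' [lpy leT' _ basic]]].
  exists (lp_support P J T0, finset (fun k => l (lp_support P J T0) k (y, T') ==
     b (lp_support P J T0) k)), T'.
  by split=> //; [exists y | exists y].
exists T; split=> [T' y lpy|]; first by apply: T_min; exists y.
have [x [T' [lpx leT' _ basic]]] := improve _ _ lpx0.
(* At the minimum the improvement cannot lower [T], so the basic point lies in the polyhedron at [T]
   itself. It is extreme in the space of pairs, hence also in this slice. *)
have eqT : T' = T by apply/eqP; rewrite eq_le leT' T_min //; exists x.
rewrite {T'}eqT in lpx leT' basic; exists x; split=> //.
move=> y z a lpy lpz a01 defx.
suff [] : (y, T : R^o) = (z, T) by [].
apply: (basic_point_extreme _ basic _ _ a01) => //.
- exact: lp_form_linear.
- exact/partial_lp_feasible.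
- exact/partial_lp_feasible.
by rewrite defx; congr (_, _); rewrite /= -[RHS]mulrDl addrC subrK mul1r.
Qed.

Lemma smallestP (R : realType) (A : set R) (c : R) :
  A c -> (forall a, A a -> c <= a) -> smallest A = c.
Proof.
move=> Ac c_min; rewrite /smallest.
have : exists a, setI A (lbound A) a by exists c; split.
move=> /(xgetPex 0) [A_s s_min]; apply/eqP; rewrite eq_le c_min // andbT.
exact: s_min.
Qed.

Lemma smallest_feasible_le (R : realType) (m n : nat) (P : 'I_n -> 'I_m -> R)
    (J : {set 'I_n}) (t : 'I_m -> R) (T : R) (x : 'M[R]_(n, m)) :
  (0 < m)%N -> partial_lp P J t T x -> smallest_feasible P J t <= T.
Proof.
move=> m_gt0 lpx; have [T0 [T0_min [y [lpy _]]]] := ex_smallest_vertex P J t m_gt0.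
rewrite /smallest_feasible (@smallestP _ _ T0) ?(T0_min _ _ lpx) //; first by exists y.
by move=> T' [z /T0_min].
Qed.

Lemma ex_vertex_smallest_feasible (R : realType) (m n : nat)
    (P : 'I_n -> 'I_m -> R) (J : {set 'I_n}) (t : 'I_m -> R) :
  (0 < m)%N -> exists x, vertex (partial_lp P J t (smallest_feasible P J t)) x.
Proof.
move=> m_gt0; have [T0 [T0_min [y ver]]] := ex_smallest_vertex P J t m_gt0.
rewrite /smallest_feasible (@smallestP _ _ T0); first by exists y.
  by exists y; case: ver.
by move=> T' [z /T0_min].
Qed.

(** * Fractional jobs at a vertex *)

(** Independent rows give an invertible maximal minor. Its determinant has a nonzero term, that is,
    a permutation along which no entry vanishes. *)
Lemma row_free_ex_injection (F : fieldType) (a b : nat) (A : 'M[F]_(a, b)) :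
  row_free A -> exists g : 'I_a -> 'I_b, injective g /\ forall e, A e (g e) != 0.
Proof.
rewrite -row_leq_rank -mxrank_tr => rkA.
have fullA : row_full A^T by rewrite /row_full eqn_leq rank_leq_col.
have := fullrowsub_unit fullA; rewrite unitmxE unitfE => det_neq0.
have [s s_neq0] : exists s : 'S_a,
    \prod_i rowsub (fullrankfun fullA) A^T i (s i) != 0.
  apply: contrapT => no; case/eqP: det_neq0; apply: big1 => s _.
  have [->|s_neq0] := eqVneq (\prod_i rowsub (fullrankfun fullA) A^T i (s i)) 0.
    by rewrite mulr0.
  by case: no; exists s.
exists (fun e => fullrankfun fullA (s^-1%g e)); split=> [e e'|e].
  by move/(@fullrankfun_inj _ _ _ _ fullA)/perm_inj.
move: s_neq0; rewrite (bigD1 (s^-1%g e)) //= mulf_eq0 negb_or => /andP [+ _].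
by rewrite !mxE permKV.
Qed.

Lemma ex_positive_step (R : realFieldType) (I : finType) (x d : I -> R) :
  (forall i, 0 <= x i) -> (forall i, x i = 0 -> d i = 0) ->
  exists2 delta, 0 < delta & forall i, `|delta * d i| <= x i.
Proof.
move=> x_ge0 xd0.
(* Adding 1 keeps the denominators positive even where [d] vanishes. *)
exists (\big[Order.min/1]_(i | x i != 0) (x i / (1 + `|d i|))).
  apply: lt_bigmin => // i xi; apply: divr_gt0; first by rewrite lt_def xi x_ge0.
  by rewrite ltr_wpDr.
move=> i; set delta := (X in X * _).
have [xi0|xi_neq0] := eqVneq (x i) 0; first by rewrite (xd0 _ xi0) mulr0 normr0.
have d1_gt0 : 0 < 1 + `|d i| by rewrite ltr_wpDr.
have delta_ge0 : 0 <= delta.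
  by apply: le_bigmin => // j _; rewrite divr_ge0 // addr_ge0.
rewrite normrM (ger0_norm delta_ge0).
apply: (@le_trans _ _ (delta * (1 + `|d i|))); first by rewrite ler_wpM2l // lerDr.
by rewrite -ler_pdivlMr // /delta; apply: bigmin_le_cond.
Qed.

(** For small [delta] both [x + delta *: d] and [x - delta *: d] are feasible, and [x] is their
    midpoint; extremality makes them equal. *)
Lemma vertex_direction0 (R : realType) (m n : nat) (P : 'I_n -> 'I_m -> R)
    (J : {set 'I_n}) (t : 'I_m -> R) (T : R) (x d : 'M[R]_(n, m)) :
  vertex (partial_lp P J t T) x ->
  (forall j i, x j i = 0 -> d j i = 0) -> (forall j, \sum_i d j i = 0) ->
  (forall i, \sum_j P j i * d j i = 0) -> d = 0.
Proof.
move=> [/partial_lpE [supp row load pos] extreme] d_supp d_row d_load.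
have [||delta delta_gt0 le_x] := @ex_positive_step R ('I_n * 'I_m)%type
    (fun ji => x ji.1 ji.2) (fun ji => d ji.1 ji.2).
- by move=> [j i]; exact: pos.
- by move=> [j i]; exact: d_supp.
have feas e : `|e| = delta -> partial_lp P J t T (x + e *: d).
  move=> e_delta; apply/partial_lpE; split=> [j i nS | j Jj | i | j i].
  - by rewrite !mxE supp // d_supp ?mulr0 ?addr0 // supp.
  - have -> : \sum_i (x + e *: d) j i = \sum_i x j i + e * \sum_i d j i.
      by rewrite mulr_sumr -big_split; apply: eq_bigr => i _; rewrite !mxE.
    by rewrite d_row mulr0 addr0 row.
  - have -> : \sum_j P j i * (x + e *: d) j i =
        \sum_j P j i * x j i + e * \sum_j P j i * d j i.
      rewrite mulr_sumr -big_split; apply: eq_bigr => j _.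
      by rewrite !mxE mulrDr [e * (_ * _)]mulrCA.
    by rewrite d_load mulr0 addr0.
  - rewrite !mxE -lerBlDl sub0r lerNl; have := le_x (j, i) => /=.
    rewrite normrM (gtr0_norm delta_gt0) -e_delta -normrM; apply: le_trans.
    by rewrite -normrN ler_norm.
have := extreme _ _ 2^-1 (feas delta _) (feas (- delta) _).
rewrite normrN gtr0_norm // => /(_ erefl erefl).
have -> : 1 - 2^-1 = 2^-1 :> R.
  by rewrite [X in X - _](splitr 1) mul1r addrK.
rewrite invr_gt0 ltr0n invf_lt1 ?ltr0n // ltr1n => /(_ isT).
rewrite scaleNr -scalerDr addrACA subrr addr0 -mulr2n -scaler_nat scalerA.
rewrite mulVf ?pnatr_eq0 // scale1r => /(_ erefl) /addrI /eqP.
by rewrite -addr_eq0 -scalerDl scaler_eq0 paddr_eq0 ?(ltW delta_gt0) //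
   (gt_eqF delta_gt0) => /eqP.
Qed.

Lemma fractional_two_positive (R : realType) (m n : nat) (P : 'I_n -> 'I_m -> R)
    (J : {set 'I_n}) (t : 'I_m -> R) (T : R) (x : 'M[R]_(n, m)) (j : 'I_n) :
  partial_lp P J t T x -> fractional x j ->
  exists i i', [/\ i != i', 0 < x j i & 0 < x j i'].
Proof.
move=> /partial_lpE [supp row load pos] /existsP [i /andP [x0 x1]].
have Jj : j \in J by apply: contraNT x0 => nJ; rewrite supp // (negPf nJ).
have xi_gt0 : 0 < x j i by rewrite lt_def x0 pos.
have := row j Jj; rewrite (bigD1 i) //=.
case: (pickP (fun i' => (i' != i) && (0 < x j i'))) => [i' /andP [ne gt0] _ | none].
  by exists i, i'; rewrite eq_sym.
rewrite big1 => [|i' ne]; first by rewrite addr0 => /eqP; rewrite (negPf x1).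
by apply/eqP; rewrite eq_le pos andbT leNgt; have := none i'; rewrite ne /= => ->.
Qed.

(* The edges [e = (j, i)] with [x j i] fractional index the rows of a matrix whose
   columns are the equations (one per job, one per machine). At a vertex its rows
   are independent, so that edges can be sent injectively to incident jobs or
   machines. A fractional job has two edges, one of which goes to its machine. *)
Lemma vertex_fractional_injection (R : realType) (m n : nat)
    (P : 'I_n -> 'I_m -> R) (J : {set 'I_n}) (t : 'I_m -> R) (T : R)
    (x : 'M[R]_(n, m)) :
  (0 < m)%N -> vertex (partial_lp P J t T) x ->
  exists f : 'I_n -> 'I_m, (forall j, fractional x j -> 0 < x j (f j)) /\
                           {in fractional x &, injective f}.
Proof.
move=> m_gt0 ver; have [lpx _] := ver.
pose edge (e : 'I_n * 'I_m) := fractional x e.1 && (0 < x e.1 e.2).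
pose E := {e | edge e}.
pose ed (a : 'I_#|{: E}|) : 'I_n * 'I_m := val (enum_val a).
have ed_inj : injective ed by move=> a a' /val_inj /enum_val_inj.
have edP a : edge (ed a) by exact: valP.
have edge_ed e : edge e -> exists a, ed a = e.
  by move=> ee; exists (enum_rank (Sub e ee : E)); rewrite /ed enum_rankK.
pose A : 'M[R]_(#|{: E}|, n + m) := \matrix_(a, c)
  match split c with
  | inl j => ((ed a).1 == j)%:R
  | inr i => P (ed a).1 (ed a).2 *+ ((ed a).2 == i)
  end.
have freeA : row_free A.
  rewrite -kermx_eq0; apply/rowV0P => u /sub_kermxP uA0.
  (* A dependency [u] between the rows is read as a direction carried by the edges. The job columns
     say that its row sums vanish, the machine columns that its loads vanish. *)
  pose d : 'M[R]_(n, m) := \matrix_(j, i) \sum_a u 0 a * (ed a == (j, i))%:R.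
  have uA c : \sum_a u 0 a * A a c = 0.
    by move/rowP/(_ c): uA0; rewrite !mxE.
  suff d0 : d = 0.
    apply/rowP => a; have := congr1 (fun M : 'M_(n, m) => M (ed a).1 (ed a).2) d0.
    rewrite !mxE -surjective_pairing (bigD1 a) //= eqxx mulr1 big1 ?addr0 //.
    by move=> a' ne; rewrite (inj_eq ed_inj) (negPf ne) mulr0.
  apply: vertex_direction0 ver _ _ _ => [j i x0 | j | i].
  - rewrite mxE big1 // => a _; case: eqP => [eq_ed|]; last by rewrite mulr0.
    by have := edP a; rewrite eq_ed /edge /= x0 ltxx andbF.
  - rewrite -[RHS](uA (lshift m j)).
    under eq_bigr => i _ do rewrite mxE.
    rewrite exchange_big; apply: eq_bigr => a _; rewrite -mulr_sumr; congr (_ * _).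
    rewrite mxE (unsplitK (inl _ j)); case: (ed a) => j' i' /=.
    rewrite (bigD1 i') //= big1 ?addr0 ?xpair_eqE ?eqxx ?andbT // => i ne.
    by rewrite xpair_eqE [i' == i]eq_sym (negPf ne) andbF.
  - rewrite -[RHS](uA (rshift n i)).
    under eq_bigr => j _ do rewrite mxE mulr_sumr.
    rewrite exchange_big; apply: eq_bigr => a _.
    under eq_bigr => j _ do rewrite mulrCA.
    rewrite -mulr_sumr; congr (_ * _).
    rewrite mxE (unsplitK (inr _ i)); case: (ed a) => j' i' /=.
    rewrite (bigD1 j') //= big1 ?addr0 => [|j ne].
      by rewrite xpair_eqE eqxx /=; case: eqP => [->|]; rewrite ?mulr1 ?mulr0.
    by rewrite xpair_eqE [j' == j]eq_sym (negPf ne) mulr0.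
have [g [g_inj gA]] := row_free_ex_injection freeA.
pose i0 := Ordinal m_gt0.
have job_edge j : exists i, fractional x j -> exists a, g a = rshift n i /\ ed a = (j, i).
  have [fj|nfj] := boolP (fractional x j); last by exists i0.
  have [i [i' [ne xi xi']]] := fractional_two_positive lpx fj.
  have [|a aE] := edge_ed (j, i); first by rewrite /edge fj.
  have [|a' aE'] := edge_ed (j, i'); first by rewrite /edge fj.
  (* A row of [A] can be nonzero only in the columns of its own job and its own machine. Injectivity
     of [g] prevents both edges of [j] from going to the column of [j]. *)
  have target b i1 : ed b = (j, i1) -> g b = lshift m j \/ g b = rshift n i1.
    move=> bE; have := gA b; rewrite mxE bE /=.
    case: splitP => c gb.
      by case: (j =P c) => [jc _|_]; rewrite ?eqxx //; left; apply/val_inj; rewrite jc.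
    by case: (i1 =P c) => [ic _|_]; rewrite ?eqxx //; right; apply/val_inj; rewrite ic.
  have [ga|ga] := target _ _ aE; last by exists i => _; exists a.
  have [ga'|ga'] := target _ _ aE'; last by exists i' => _; exists a'.
  have aa' : a = a' by apply: g_inj; rewrite ga ga'.
  by case/eqP: ne; move: aE'; rewrite -aa' aE => -[].
have [f fP] := choice job_edge; exists f; split=> [j fj | j j' fj fj' eqf].
  by have [a [_ aE]] := fP _ fj; have := edP a; rewrite aE => /andP [].
have [a [ga aE]] := fP _ fj; have [a' [ga' aE']] := fP _ fj'.
have aa' : a = a' by apply: g_inj; rewrite ga ga' eqf.
by move: aE; rewrite aa' aE' => -[].
Qed.

(** * Lower bounds and roundings *)

Lemma makespan_leP (R : realType) (m n : nat) (P : 'I_n -> 'I_m -> R)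
    (sigma : schedule m n) (T : R) :
  0 <= T -> (makespan P sigma <= T <-> forall i, completion P sigma i <= T).
Proof.
move=> T_ge0; split=> [/bigmax_leP [_ le_T] i | le_T]; first exact: le_T.
by apply/bigmax_leP; split.
Qed.

Lemma completion_le_makespan (R : realType) (m n : nat) (P : 'I_n -> 'I_m -> R)
    (sigma : schedule m n) (i : 'I_m) :
  completion P sigma i <= makespan P sigma.
Proof. exact: le_bigmax. Qed.

Lemma profile_nil (R : realType) (m n : nat) (P : 'I_n -> 'I_m -> R) (i : 'I_m) :
  profile P [::] i = 0.
Proof. by rewrite /profile big1 // => j; rewrite onth0n. Qed.

Lemma profile_ge0 (R : realType) (m n : nat) (P : 'I_n -> 'I_m -> R)
    (v : node m) (i : 'I_m) :
  (forall j i, 0 <= P j i) -> 0 <= profile P v i.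
Proof. by move=> P_ge0; apply: sumr_ge0. Qed.

Lemma profile_rcons (R : realType) (m n : nat) (P : 'I_n -> 'I_m -> R)
    (v : node m) (j : 'I_n) (i0 i : 'I_m) :
  j = size v :> nat ->
  profile P (rcons v i0) i = profile P v i + P j i *+ (i0 == i).
Proof.
move=> jE; rewrite /profile [LHS]big_mkcond [X in X + _]big_mkcond /=.
rewrite !(bigD1 (P := xpredT) j) //=.
rewrite -cats1 !onth_cat jE ltnn subnn /= onth_default // add0r addrC.
congr (_ + _); last by rewrite -[Some i0 == _]/(i0 == i); case: eqP.
apply: eq_bigr => k ne; rewrite onth_cat; case: ltnP => // le_vk.
have lt_vk : (size v < k)%N.
  by rewrite ltn_neqAle le_vk andbT -jE eq_sym -val_eqE in ne *.
rewrite [onth v k]onth_default //.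
by rewrite onth_default //= subn_gt0.
Qed.

Lemma node_lp_fractional_unfixed (R : realType) (m n : nat)
    (P : 'I_n -> 'I_m -> R) (v : node m) (x : 'M[R]_(n, m)) (j : 'I_n) :
  node_lp P v x -> fractional x j -> j \in unfixed n v.
Proof.
move=> [supp _ _ _] /existsP [i /andP [x0 _]].
by apply: contraNT x0 => nJ; rewrite supp // (negPf nJ).
Qed.

Lemma node_lp_ex_one (R : realType) (m n : nat) (P : 'I_n -> 'I_m -> R)
    (v : node m) (x : 'M[R]_(n, m)) (j : 'I_n) :
  node_lp P v x -> j \in unfixed n v -> ~~ fractional x j -> exists i, x j i = 1.
Proof.
move=> /partial_lpE [_ row _ _] Jj nfj; apply: contrapT => no1.
have := row j Jj; rewrite big1 => [/eqP|i _]; first by rewrite eq_sym oner_eq0.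
move: nfj; rewrite negb_exists => /forallP/(_ i); rewrite negb_and !negbK.
by case/orP => /eqP // x1; case: no1; exists i.
Qed.

Lemma ex_rounding (R : realType) (m n : nat) (P : 'I_n -> 'I_m -> R)
    (v : node m) (x : 'M[R]_(n, m)) :
  (0 < m)%N -> vertex (node_lp P v) x -> exists sigma, rounding v x sigma.
Proof.
move=> m_gt0 ver; have [lpx _] := ver.
have [f [f_pos f_inj]] := vertex_fractional_injection m_gt0 ver.
have /choice [g gP] j : exists i, j \in unfixed n v -> ~~ fractional x j -> x j i = 1.
  have [Jj|] := boolP (j \in unfixed n v); last by exists (Ordinal m_gt0).
  have [|nf] := boolP (fractional x j); first by exists (Ordinal m_gt0).
  by have [i] := node_lp_ex_one lpx Jj nf; exists i.
exists [ffun j : 'I_n => if j \in unfixed n v then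
    if fractional x j then f j else g j else odflt (g j) (onth v j)].
split=> [j lt_jv | j Jj nf | j fj | j j' fj fj'].
- rewrite ffunE inE leqNgt lt_jv /=; move: lt_jv; rewrite -onthTE.
  by case: (onth v j).
- by rewrite ffunE Jj (negPf nf) gP.
- by rewrite ffunE (node_lp_fractional_unfixed lpx fj) fj f_pos.
- rewrite !ffunE !(node_lp_fractional_unfixed lpx) //.
  rewrite (fj : is_true (fractional x j)) (fj' : is_true (fractional x j')).
  exact: f_inj.
Qed.

(** Job by job: a fixed job is counted in the profile, a nonfractional unfixed one in the load of
    [x], a fractional one in the extra sum. Profile and load together are at most [LB P v]. *)
Lemma rounding_completion_le (R : realType) (m n : nat) (P : 'I_n -> 'I_m -> R)
    (v : node m) (x : 'M[R]_(n, m)) (sigma : schedule m n) (i : 'I_m) :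
  (forall j i, 0 <= P j i) -> node_lp P v x -> rounding v x sigma ->
  completion P sigma i <=
    LB P v + \sum_(j | fractional x j && (sigma j == i)) P j i.
Proof.
move=> P_ge0 /partial_lpE [_ _ load pos] [fixed ones _ _].
have {load} := load i; rewrite lerBrDl.
rewrite -(lerD2r (\sum_(j | fractional x j && (sigma j == i)) P j i)).
apply: le_trans; rewrite /completion /profile.
rewrite big_mkcond [X in X + _ + _]big_mkcond [X in _ + X]big_mkcond -!big_split /=.
apply: ler_sum => j _.
have ge0 (b : bool) : 0 <= (if b then P j i else 0) by case: b.
have Px_ge0 : 0 <= P j i * x j i by rewrite mulr_ge0.
case: (eqVneq (sigma j) i) => [sj|_]; last by rewrite !addr_ge0.
have [lt_jv|le_vj] := ltnP j (size v).
  by rewrite fixed // sj eqxx -addrA lerDl addr_ge0.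
have [fj|nfj] := boolP (fractional x j); first by rewrite lerDr addr_ge0.
have x1 : x j i = 1 by rewrite -sj ones ?inE.
by rewrite x1 mulr1 addr0 lerDr ge0.
Qed.

Lemma rounding_integral_makespan (R : realType) (m n : nat)
    (P : 'I_n -> 'I_m -> R) (v : node m) (x : 'M[R]_(n, m))
    (sigma : schedule m n) :
  (forall j i, 0 <= P j i) -> 0 <= LB P v -> node_lp P v x -> integral x ->
  rounding v x sigma -> makespan P sigma <= LB P v.
Proof.
move=> P_ge0 LB_ge0 lpx /forallP int rnd; apply/makespan_leP => // i.
have := rounding_completion_le i P_ge0 lpx rnd.
by rewrite big_pred0 ?addr0 // => j; rewrite (negPf (int j)).
Qed.

(** Injectivity gives each machine at most one fractional job. Its edge carries a positive variable,
    so its time is at most [LB P v]. *)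
Lemma rounding_makespan_le2 (R : realType) (m n : nat)
    (P : 'I_n -> 'I_m -> R) (v : node m) (x : 'M[R]_(n, m))
    (sigma : schedule m n) :
  (forall j i, 0 <= P j i) -> 0 <= LB P v -> node_lp P v x ->
  rounding v x sigma -> makespan P sigma <= 2 * LB P v.
Proof.
move=> P_ge0 LB_ge0 lpx rnd; apply/makespan_leP => [|i]; first by rewrite mulr_ge0.
apply: le_trans (rounding_completion_le i P_ge0 lpx rnd) _.
rewrite mulrDl mul1r lerD2l; have [supp _ _ _] := lpx; have [_ _ fpos finj] := rnd.
case: (pickP (fun j => fractional x j && (sigma j == i))) => [j /andP [fj sj] | none].
  rewrite (bigD1 j) ?fj //= big1 => [|j' /andP [/andP [fj' /eqP sj'] ne]].
    rewrite addr0 leNgt; apply/negP => ltP; have := fpos _ fj.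
    by rewrite (eqP sj) supp ?ltxx // negb_and -ltNge ltP orbT.
  by case/eqP: ne; apply: finj => //; rewrite sj' (eqP sj).
by rewrite big_pred0.
Qed.

(** The 0/1 matrix of [sigma] on the unfixed jobs is feasible at [T]. A pair outside the support
    would alone push its machine beyond [T]. *)
Lemma LB_le_completion (R : realType) (m n : nat) (P : 'I_n -> 'I_m -> R)
    (v : node m) (sigma : schedule m n) (T : R) :
  (0 < m)%N -> (forall j i, 0 <= P j i) ->
  (forall i, profile P v i +
     \sum_(j < n | (size v <= j)%N && (sigma j == i)) P j i <= T) ->
  LB P v <= T.
Proof.
move=> m_gt0 P_ge0 leT.
apply: (@smallest_feasible_le _ _ _ _ _ _ _
  (\matrix_(j, i) ((size v <= j)%N && (sigma j == i))%:R)) => //.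
apply/partial_lpE; split=> [j i | j | i | j i].
- rewrite mxE inE; have [le_vj|//] := boolP (size v <= j)%N.
  case: eqP => //= sj; rewrite -ltNge => ltP; have := leT i.
  rewrite leNgt (lt_le_trans ltP) // (bigD1 j) ?le_vj ?sj ?eqxx //= addrCA lerDl.
  by rewrite addr_ge0 ?profile_ge0 // sumr_ge0.
- rewrite inE => le_vj; rewrite (bigD1 (sigma j)) //= big1 => [|i ne].
    by rewrite mxE le_vj eqxx addr0.
  by rewrite mxE eq_sym (negPf ne) andbF.
- rewrite lerBrDl; apply: le_trans (leT i); rewrite lerD2l big_mkcond /=.
  rewrite [leRHS]big_mkcond; apply: ler_sum => j _.
  by rewrite mxE; case: ifP; rewrite ?mulr1 ?mulr0.
- by rewrite mxE ler0n.
Qed.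

(** Adding the assignments fixed at [v] to a solution at [v] gives a solution at the root: the
    overheads become loads. The fixed pairs are in the support because the profile is at most
    [LB P v]. *)
Lemma LB_nil_le (R : realType) (m n : nat) (P : 'I_n -> 'I_m -> R) (v : node m) :
  (0 < m)%N -> (forall j i, 0 <= P j i) -> LB P [::] <= LB P v.
Proof.
move=> m_gt0 P_ge0.
have [y [/partial_lpE [supp row load pos] _]] :=
  ex_vertex_smallest_feasible P (unfixed n v) (profile P v) m_gt0.
apply: (@smallest_feasible_le _ _ _ _ _ _ _
  (\matrix_(j, i) (y j i + (onth v j == Some i)%:R))) => //.
have prof_le i : profile P v i <= LB P v.
  have := load i; rewrite lerBrDl; apply: le_trans.
  by rewrite lerDl sumr_ge0 // => j _; rewrite mulr_ge0.
apply/partial_lpE; split=> [j i | j _ | i | j i].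
- rewrite mxE inE -ltNge => ltP; rewrite supp ?negb_and -?ltNge ?ltP ?orbT // add0r.
  case: eqP => // vj; have := prof_le i.
  rewrite leNgt (lt_le_trans ltP) // /profile (bigD1 j) ?vj //= lerDl.
  by rewrite sumr_ge0.
- under eq_bigr => i _ do rewrite mxE.
  rewrite big_split /=; have [le_vj|lt_jv] := leqP (size v) j.
    by rewrite row ?inE // big1 ?addr0 // => i _; rewrite onth_default.
  rewrite big1 => [|i _]; last by rewrite supp // inE leqNgt lt_jv.
  move: lt_jv; rewrite -onthTE; case: (onth v j) => // i _.
  rewrite (bigD1 i) //= eqxx big1 ?addr0 ?add0r // => i' ne.
  by rewrite -[_ == _]/(i == i') eq_sym (negPf ne).
- rewrite profile_nil subr0; have := load i; rewrite lerBrDl; apply: le_trans.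
  rewrite /profile [X in _ <= X + _]big_mkcond -big_split; apply: ler_sum => j _.
  by rewrite mxE mulrDr addrC lerD2r; case: ifP; rewrite ?mulr1 ?mulr0.
- by rewrite mxE addr_ge0.
Qed.

Lemma LB_nil_ge0 (R : realType) (m n : nat) (P : 'I_n -> 'I_m -> R) :
  (0 < m)%N -> (forall j i, 0 <= P j i) -> 0 <= LB P [::].
Proof.
move=> m_gt0 P_ge0.
have [y [/partial_lpE [_ _ load pos] _]] :=
  ex_vertex_smallest_feasible P (unfixed n ([::] : node m)) (profile P [::]) m_gt0.
have := load (Ordinal m_gt0); rewrite profile_nil subr0; apply: le_trans.
by apply: sumr_ge0 => j _; rewrite mulr_ge0.
Qed.

(** Were all times of [j] positive, no variable of [j] would survive at [T = 0] and its row could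
    not sum to 1. This serves the case where normalizing would divide by 0. *)
Lemma LB_nil_eq0 (R : realType) (m n : nat) (P : 'I_n -> 'I_m -> R) (j : 'I_n) :
  (0 < m)%N -> LB P [::] = 0 -> exists i, P j i <= 0.
Proof.
move=> m_gt0 LB0.
have [y [/partial_lpE [supp row _ _] _]] :=
  ex_vertex_smallest_feasible P (unfixed n ([::] : node m)) (profile P [::]) m_gt0.
apply: contrapT => no; have := row j; rewrite inE big1 => [/(_ isT)/eqP|i _].
  by rewrite eq_sym oner_eq0.
apply: supp; rewrite inE /=; apply/negP => le0; apply: no; exists i.
by rewrite -LB0.
Qed.

(** Dividing the times by [c] turns the root polyhedron at [c * T] into the one at [T], with the
    same matrices. *)
Lemma LB_nil_normalized (R : realType) (m n : nat) (P : 'I_n -> 'I_m -> R) :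
  (0 < m)%N -> 0 < LB P [::] -> LB (normalized P) [::] = 1.
Proof.
move=> m_gt0; set c := LB P [::] => c_gt0.
have scaleE T x : partial_lp (normalized P) (unfixed n ([::] : node m))
      (profile (normalized P) [::]) T x <->
    partial_lp P (unfixed n ([::] : node m)) (profile P [::]) (c * T) x.
  have leE j i : (normalized P j i <= T) = (P j i <= c * T).
    by rewrite /normalized -/c ler_pdivrMr // mulrC.
  have loadE i : (\sum_j normalized P j i * x j i <= T - profile (normalized P) [::] i)
      = (\sum_j P j i * x j i <= c * T - profile P [::] i).
    rewrite !profile_nil !subr0 mulrC -ler_pdivrMr // mulr_suml.
    by under eq_bigr => j _ do rewrite /normalized -/c mulrAC.
  rewrite !partial_lpE; split=> [] [supp row load pos]; split=> //.
  - by move=> j i; rewrite -leE; exact: supp.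
  - by move=> i; rewrite -loadE.
  - by move=> j i; rewrite leE; exact: supp.
  - by move=> i; rewrite loadE.
have [x [lpx _]] :=
  ex_vertex_smallest_feasible P (unfixed n ([::] : node m)) (profile P [::]) m_gt0.
have [y [/scaleE lpy _]] :=
  ex_vertex_smallest_feasible (normalized P) (unfixed n ([::] : node m))
    (profile (normalized P) [::]) m_gt0.
apply/eqP; rewrite eq_le; apply/andP; split.
  by apply: (smallest_feasible_le m_gt0); apply/scaleE; rewrite mulr1; exact: lpx.
have := smallest_feasible_le m_gt0 lpy.
by rewrite -/(LB P [::]) -/c -ler_pdivrMl // mulVf // gt_eqF.
Qed.

(** * Number of nodes and progress *)

Definition dissimilar_nodes (R : realType) (m n : nat) (P : 'I_n -> 'I_m -> R)
    (eps : R) (g : seq (node m)) : Prop :=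
  [/\ uniq g, forall u, u \in g -> (size u <= n)%N,
      forall u i, u \in g -> profile P u i <= 2 * (1 + eps) ^+ 2 &
      forall u w, u \in g -> w \in g -> size u = size w ->
        similar_profiles P eps u w -> u = w].

Lemma similar_profiles_refl (R : realType) (m n : nat) (P : 'I_n -> 'I_m -> R)
    (eps : R) (u : node m) :
  0 < eps -> similar_profiles P eps u u.
Proof. by move=> /ltW eps_ge0 i; rewrite subrr normr0 divr_ge0. Qed.

Lemma similar_profiles_sym (R : realType) (m n : nat) (P : 'I_n -> 'I_m -> R)
    (eps : R) (u w : node m) :
  similar_profiles P eps u w -> similar_profiles P eps w u.
Proof. by move=> sim i; rewrite distrC. Qed.

Lemma insert_child_dissimilar (R : realType) (m n : nat) (P : 'I_n -> 'I_m -> R)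
    (eps : R) (st : state m n) (u : node m) :
  0 < eps -> (size u <= n)%N -> dissimilar_nodes P eps (generated st) ->
  dissimilar_nodes P eps (generated (insert_child P eps st u)).
Proof.
move=> eps_gt0 le_un [g_uniq g_size g_prof g_sim]; rewrite /insert_child.
case: asboolP => // not_disc /=.
have small i : profile P u i <= 2 * (1 + eps) ^+ 2.
  rewrite leNgt; apply/negP => big; apply: not_disc; apply: Or32.
  exact: lt_le_trans big (le_bigmax _ _ _).
have not_sim w : w \in generated st -> size w = size u ->
    ~ similar_profiles P eps w u.
  by move=> gw sw sim; apply: not_disc; apply: Or33; exists w.
split=> [|w|w i|w w'].
- rewrite /= g_uniq andbT; apply/negP => /not_sim/(_ erefl).
  by apply; exact: similar_profiles_refl.
- by rewrite in_cons => /orP [/eqP -> //|/g_size].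
- by rewrite in_cons => /orP [/eqP -> //|/g_prof].
rewrite !in_cons => /orP [/eqP ->|gw] /orP [/eqP ->|gw'] //; last exact: g_sim.
- by move=> /esym sw' /similar_profiles_sym /(not_sim _ gw' sw').
- by move=> sw /(not_sim _ gw sw).
Qed.

Definition extends (m n : nat) (st st' : state m n) : Prop :=
  exists new, [/\ active st' = new ++ active st, generated st' = new ++ generated st,
                  found st' = found st & stopped st' = stopped st].

Lemma foldl_insert_child_extends (R : realType) (m n : nat)
    (P : 'I_n -> 'I_m -> R) (eps : R) (us : seq (node m)) (st : state m n) :
  extends st (foldl (insert_child P eps) st us).
Proof.
elim: us st => [|u us IHus] st /=; first by exists [::].
have [new [actE genE foundE stopE]] := IHus (insert_child P eps st u).
rewrite /extends {}actE {}genE {}foundE {}stopE /insert_child.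
case: ifP => _; first by exists new.
by exists (new ++ [:: u]); rewrite -!catA.
Qed.

Lemma discarded_extends (R : realType) (m n : nat) (P : 'I_n -> 'I_m -> R)
    (eps : R) (st st' : state m n) (u : node m) :
  extends st st' -> discarded P eps st u -> discarded P eps st' u.
Proof.
move=> [new [_ genE foundE _]] [dom | big | [w gw sim]].
- by apply: Or31; rewrite foundE.
- exact: Or32.
- by apply: Or33; exists w; rewrite // genE mem_cat gw orbT.
Qed.

(* A child that is kept is similar to itself, so that all the children can be
   regarded as discarded once the branching is over. *)
Lemma foldl_insert_child_discarded (R : realType) (m n : nat)
    (P : 'I_n -> 'I_m -> R) (eps : R) (us : seq (node m)) (st : state m n)
    (u : node m) :
  0 < eps -> u \in us -> discarded P eps (foldl (insert_child P eps) st us) u.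
Proof.
move=> eps_gt0; elim: us st => [|u' us IHus] st //=; rewrite in_cons.
case/orP => [/eqP <- {u'}|]; last exact: IHus.
apply: (discarded_extends (foldl_insert_child_extends P eps us _)).
rewrite /insert_child; case: asboolP => // _; apply: Or33; exists u => /=.
  exact: mem_head.
by split=> //; exact: similar_profiles_refl.
Qed.

Lemma foldl_insert_child_dissimilar (R : realType) (m n : nat)
    (P : 'I_n -> 'I_m -> R) (eps : R) (us : seq (node m)) (st : state m n) :
  0 < eps -> (forall u, u \in us -> (size u <= n)%N) ->
  dissimilar_nodes P eps (generated st) ->
  dissimilar_nodes P eps (generated (foldl (insert_child P eps) st us)).
Proof.
move=> eps_gt0; elim: us st => [|u us IHus] st //= le_n dis.
apply: IHus => [w usw|]; first by rewrite le_n // in_cons usw orbT.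
by apply: insert_child_dissimilar => //; rewrite le_n // mem_head.
Qed.

(* Only the last processed node, the head of [done], may have depth [n], and it
   stops the algorithm. *)
Definition processed (m n : nat) (done : seq (node m)) (st : state m n) : Prop :=
  [/\ perm_eq (done ++ active st) (generated st),
      forall u, u \in behead done -> (size u < n)%N,
      ~~ stopped st -> forall u, u \in done -> (size u < n)%N &
      found st = [::] -> active st <> [::] /\ ~~ stopped st].

Lemma nonintegral_depth (R : realType) (m n : nat) (P : 'I_n -> 'I_m -> R)
    (v : node m) (x : 'M[R]_(n, m)) :
  node_lp P v x -> ~~ integral x -> (size v < n)%N.
Proof.
move=> lpx; rewrite negb_forall => /existsP [j]; rewrite negbK => fj.
have := node_lp_fractional_unfixed lpx fj; rewrite inE => le_vj.
exact: leq_ltn_trans le_vj (ltn_ord j).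
Qed.

Lemma perm_cons_rem (T : eqType) (s t : seq T) (x : T) :
  x \in t -> perm_eq ((x :: s) ++ rem x t) (s ++ t).
Proof.
move=> tx; rewrite -cat1s -catA perm_catCA cat1s perm_cat2l perm_sym.
exact: perm_to_rem.
Qed.

Lemma run_invariant (R : realType) (m n : nat) (P : 'I_n -> 'I_m -> R)
    (eps : R) (k : nat) (st : state m n) :
  0 < eps -> run P eps k st ->
  [/\ dissimilar_nodes P eps (generated st), [::] \in generated st &
      exists2 done, size done = k & processed done st].
Proof.
move=> eps_gt0; elim=> {k st} [|k st st' _ [dis root [done sz_done]]].
  split; last by exists [::].
    split=> // [u|u i|u w].
    - by rewrite inE => /eqP ->.
    - rewrite inE => /eqP ->; rewrite profile_nil mulr_ge0 // exprn_ge0 //.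
      by rewrite addr_ge0 // ltW.
    - by rewrite !inE => /eqP -> /eqP ->.
  exact: mem_head.
move=> [perm behind deep fnd] stp; case: stp dis root perm behind deep fnd => {st'}.
  move=> v x0 sigma not_term [act_v _] _ _ _ dis root perm behind deep _.
  split=> //; exists (v :: done); first by rewrite /= sz_done.
  (* Steps start only from states that have not terminated, so all nodes processed earlier have
     depth less than [n]. *)
  have unstopped : ~~ stopped st by apply/negP => s; apply: not_term; apply: Or31.
  split=> //=; last by move=> u; exact: deep.
  exact: perm_trans (perm_cons_rem _ act_v) perm.
move=> v x0 x sigma not_term [act_v _] [lpx0 _] nint _ _ dis root perm behind deep _.
have lt_vn := nonintegral_depth lpx0 nint.
rewrite /branch; set st1 := State _ _ _ _; set us := map _ _.
have [new [actE genE foundE stopE]] := foldl_insert_child_extends P eps us st1.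
have unstopped : ~~ stopped st by apply/negP => s; apply: not_term; apply: Or31.
split.
- by apply: foldl_insert_child_dissimilar => // u /mapP [i _ ->]; rewrite size_rcons.
- by rewrite genE mem_cat root orbT.
exists (v :: done); first by rewrite /= sz_done.
split.
- rewrite actE genE perm_sym.
  apply: (@perm_trans _ (new ++ (v :: done) ++ rem v (active st))); last first.
    by rewrite perm_catCA.
  by rewrite perm_cat2l perm_sym; apply: perm_trans (perm_cons_rem _ act_v) perm.
- exact: deep.
- by move=> _ u; rewrite in_cons => /orP [/eqP ->|]; [|exact: deep].
- by rewrite foundE.
Qed.

Lemma card_dissimilar_nodes (R : realType) (m n : nat) (P : 'I_n -> 'I_m -> R)
    (eps : R) (g s : seq (node m)) :
  (0 < n)%N -> 0 < eps -> (forall j i, 0 <= P j i) -> dissimilar_nodes P eps g ->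
  uniq s -> {subset s <= g} -> (forall u, u \in s -> (size u < n)%N) ->
  (size s <= n * (Num.truncn (2 * (n%:R * (1 + eps) ^+ 2 / eps))).+1 ^ m)%N.
Proof.
move=> n_gt0 eps_gt0 P_ge0 [_ _ g_prof g_sim] s_uniq sg s_size.
set K := Num.truncn _.
pose q : R := n%:R / eps.
have nR_gt0 : 0 < n%:R :> R by rewrite ltr0n.
have q_gt0 : 0 < q by rewrite divr_gt0.
(* The depth together with the grid cell of the profile; [q] is the inverse of the mesh. The
   defaults of [insubd] and [inord] do not occur on [s], since depths are below [n] and truncations
   at most [K]. *)
pose cell (u : node m) : 'I_n * {ffun 'I_m -> 'I_K.+1} :=
  (insubd (Ordinal n_gt0) (size u), [ffun i => inord (Num.truncn (profile P u i * q))]).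
have cell_inj : {in s &, injective cell}.
  move=> u w su sw [/(congr1 val) + /ffunP eq_cell].
  rewrite !val_insubd !s_size // => eq_size.
  apply: g_sim => //; [exact: sg | exact: sg | move=> i].
  have truncK z : z \in s -> (Num.truncn (profile P z i * q) < K.+1)%N.
    move=> sz; rewrite ltnS le_truncn //.
    have -> : 2 * (n%:R * (1 + eps) ^+ 2 / eps) = 2 * (1 + eps) ^+ 2 * q.
      by rewrite /q mulrA [X in _ = X]mulrA [n%:R * _]mulrC !mulrA.
    by rewrite ler_wpM2r ?(ltW q_gt0) // g_prof // sg.
  have := eq_cell i; rewrite !ffunE => /(congr1 val); rewrite /= !inordK ?truncK //.
  move=> eq_trunc.
  have q_ge0 z : 0 <= profile P z i * q by rewrite mulr_ge0 ?profile_ge0 // ltW.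
  have /andP [u1 u2] := truncn_itv (q_ge0 u).
  have /andP [w1 w2] := truncn_itv (q_ge0 w).
  rewrite -invf_div -/q -[X in _ <= X]mul1r ler_pdivlMr //.
  rewrite -[q in X in X <= _]gtr0_norm // -normrM mulrBl.
  rewrite eq_trunc in u1 u2; rewrite -natr1 in u2 w2.
  (* Two scaled coordinates with the same truncation differ by less than 1. *)
  by rewrite ler_norml; apply/andP; split; lra.
rewrite -(size_map cell) -(card_uniqP _) ?map_inj_in_uniq //.
by apply: leq_trans (max_card _) _; rewrite card_prod card_ffun !card_ord.
Qed.

Lemma run_node_bound (R : realType) (m n : nat) (P : 'I_n -> 'I_m -> R)
    (eps : R) (k : nat) (st : state m n) :
  (0 < m)%N -> (0 < n)%N -> 0 < eps -> (forall j i, 0 <= P j i) ->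
  run P eps k st -> k%:R <= n%:R * (3 * n%:R * (1 + eps) ^+ 2 / eps) ^+ m.
Proof.
move=> m_gt0 n_gt0 eps_gt0 P_ge0 /(run_invariant eps_gt0).
move=> [dis _ [done <- [perm behind _ _]]].
have g_uniq : uniq (done ++ active st) by rewrite (perm_uniq perm); case: dis.
have done_uniq : uniq done by move: g_uniq; rewrite cat_uniq => /andP [].
have sub : {subset done <= generated st}.
  by move=> u du; rewrite -(perm_mem perm) mem_cat du.
have := card_dissimilar_nodes n_gt0 eps_gt0 P_ge0 dis (s := behead done).
set K := Num.truncn _ => le_size.
have {le_size} : (size (behead done) <= n * K.+1 ^ m)%N.
  apply: le_size => //.
    by case: (done) done_uniq => //= ? ? /andP [].
  by move=> u du; apply: sub; exact: mem_behead.
rewrite size_behead => le_size.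
(* The one processed node that may have depth [n] is absorbed by passing from [K.+1] to [K.+2]. *)
have {}le_size : (size done <= n * K.+2 ^ m)%N.
  apply: (@leq_trans (n * K.+1 ^ m).+1); first by rewrite -ltnS; case: size le_size.
  apply: (@leq_trans (n * (K.+1 ^ m).+1)); first by rewrite mulnS -add1n leq_add2r.
  by rewrite leq_pmul2l // ltn_exp2r.
apply: (@le_trans _ _ (n * K.+2 ^ m)%:R); first by rewrite ler_nat.
rewrite natrM natrX ler_wpM2l //; apply: lerXn2r; rewrite ?nnegrE //.
  by rewrite divr_ge0 ?(ltW eps_gt0) // mulr_ge0 ?sqr_ge0 // mulr_ge0.
have nR_ge1 : 1 <= n%:R :> R by rewrite ler1n.
pose c := n%:R * (1 + eps) ^+ 2 / eps.
(* From [(1 - eps) ^+ 2 >= 0]. It gives [K + 2 <= 2 * c + 2 <= 3 * c], whence the constant 3. *)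
have c_ge4 : 4 <= c.
  rewrite /c ler_pdivlMr //; apply: (@le_trans _ _ (1 * (1 + eps) ^+ 2)).
    by have := sqr_ge0 (1 - eps); rewrite !expr2; nra.
  by rewrite ler_wpM2r // sqr_ge0.
have -> : 3 * n%:R * (1 + eps) ^+ 2 / eps = 3 * c by rewrite /c -!mulrA.
have le_K : K%:R <= 2 * c by rewrite /K -/c truncn_le; lra.
by rewrite -[K.+2]addn2 natrD; lra.
Qed.

Lemma ex_least (R : realType) (T : eqType) (f : T -> R) (s : seq T) :
  s <> [::] -> exists2 x, x \in s & forall y, y \in s -> f x <= f y.
Proof.
elim: s => // x s IHs _; have [->|/eqP /IHs [y sy y_min]] := eqVneq s [::].
  by exists x; rewrite ?mem_head // => y; rewrite inE => /eqP ->.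
have [le_xy|/ltW le_yx] := lerP (f x) (f y).
  exists x; rewrite ?mem_head // => z; rewrite in_cons => /orP [/eqP -> //|sz].
  exact: le_trans le_xy (y_min _ sz).
exists y; first by rewrite in_cons sy orbT.
by move=> z; rewrite in_cons => /orP [/eqP -> //|/y_min].
Qed.

Lemma run_progress (R : realType) (m n : nat) (P : 'I_n -> 'I_m -> R)
    (eps : R) (st : state m n) :
  (0 < m)%N -> ~ terminated P eps st -> exists st', step P eps st st'.
Proof.
move=> m_gt0 not_term.
have act : active st <> [::] by move=> act0; apply: not_term; apply: Or32.
have [v act_v v_min] := ex_least (LB P) act.
have low : lowest_active P st v by split.
have [x0 ver] : exists x0, vertex (node_lp P v) x0 by exact: ex_vertex_smallest_feasible.
have [int|nint] := boolP (integral x0).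
  have [sigma rnd] := ex_rounding m_gt0 ver.
  by eexists; exact: step_integral not_term low ver int rnd.
have [x [ch ver_x]] : exists x, chosen_vertex P v x0 x /\ vertex (node_lp P v) x.
  have [[x [ver_x frac]]|none] :=
      pselect (exists x, vertex (node_lp P v) x /\ longest_fractional v x).
    by exists x; split=> //; left.
  exists x0; split=> //; right; split=> // y ver_y frac; apply: none.
  by exists y.
have [sigma rnd] := ex_rounding m_gt0 ver_x.
by eexists; exact: step_branch not_term low ver nint ch rnd.
Qed.

Lemma run_returns (R : realType) (m n : nat) (P : 'I_n -> 'I_m -> R)
    (eps : R) (k : nat) (st : state m n) :
  0 < eps -> run P eps k st -> terminated P eps st ->
  exists sigma, returns P eps st sigma.
Proof.
move=> eps_gt0 /(run_invariant eps_gt0) [_ _ [done _ [_ _ _ fnd]]] term.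
have /(ex_least (makespan P)) [sigma] : found st <> [::].
  move=> found0; have [act unstopped] := fnd found0.
  case: term => [s|//|[sigma [v [[]]]]]; first by rewrite s in unstopped.
  by rewrite found0.
by exists sigma.
Qed.

(** * Quality of the returned schedule *)

(* Completing [w] with the machines of [sigma] is almost as good as [sigma]; a
   discarding by similarity costs at most [eps / n] per level of the tree. *)
Definition promising (R : realType) (m n : nat) (P : 'I_n -> 'I_m -> R) (eps : R)
    (sigma : schedule m n) (w : node m) : Prop :=
  forall i, profile P w i + \sum_(j < n | (size w <= j)%N && (sigma j == i)) P j i
    <= makespan P sigma + (size w)%:R * (eps / n%:R).

Definition near_optimal_found (R : realType) (m n : nat) (P : 'I_n -> 'I_m -> R)
    (eps : R) (sigma : schedule m n) (st : state m n) : Prop :=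
  exists2 tau, tau \in found st & makespan P tau <= (1 + eps) * makespan P sigma.

Lemma promising_nil (R : realType) (m n : nat) (P : 'I_n -> 'I_m -> R) (eps : R)
    (sigma : schedule m n) :
  promising P eps sigma [::].
Proof.
move=> i; rewrite profile_nil add0r mul0r addr0.
exact: completion_le_makespan.
Qed.

Lemma completion_rcons (R : realType) (m n : nat) (P : 'I_n -> 'I_m -> R)
    (sigma : schedule m n) (v : node m) (j : 'I_n) (i : 'I_m) :
  j = size v :> nat ->
  profile P (rcons v (sigma j)) i +
    \sum_(k < n | (size v < k)%N && (sigma k == i)) P k i =
  profile P v i + \sum_(k < n | (size v <= k)%N && (sigma k == i)) P k i.
Proof.
move=> jE; rewrite (profile_rcons _ _ _ jE) -addrA; congr (_ + _).
rewrite [RHS](bigID (pred1 j)) /=; congr (_ + _).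
  rewrite big_mkcond (bigD1 j) //= eqxx jE leqnn andbT big1 ?addr0 => [|k ne].
    by case: eqP.
  by rewrite (negPf ne) andbF.
apply: eq_bigl => k; rewrite andbAC ltn_neqAle -jE andbC [_ == _ :> nat]eq_sym.
by rewrite andbC [X in _ = X && _]andbC.
Qed.

(** Fixing [j] as [sigma] does leaves the completion unchanged, and similarity costs at most the
    [eps / n] granted to the new level. This covers both the child itself and a node standing in for
    it. *)
Lemma promising_child (R : realType) (m n : nat) (P : 'I_n -> 'I_m -> R)
    (eps : R) (sigma : schedule m n) (v w : node m) (j : 'I_n) :
  j = size v :> nat -> promising P eps sigma v -> size w = (size v).+1 ->
  similar_profiles P eps w (rcons v (sigma j)) -> promising P eps sigma w.
Proof.
move=> jE prom sw sim i; have := prom i; rewrite -(completion_rcons P _ _ jE).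
rewrite sw -natr1 [X in _ -> _ <= _ + X]mulrDl mul1r.
by have := sim i; rewrite ler_norml => /andP []; lra.
Qed.

(** At most [n] levels lose at most [eps] in all, and [eps <= eps * makespan P sigma]. *)
Lemma promising_completion_le (R : realType) (m n : nat) (P : 'I_n -> 'I_m -> R)
    (eps : R) (sigma : schedule m n) (w : node m) (i : 'I_m) :
  (0 < n)%N -> 0 < eps -> 1 <= makespan P sigma -> (size w <= n)%N ->
  promising P eps sigma w ->
  profile P w i + \sum_(j < n | (size w <= j)%N && (sigma j == i)) P j i
    <= (1 + eps) * makespan P sigma.
Proof.
move=> n_gt0 eps_gt0 opt_ge1 le_wn prom; apply: le_trans (prom i) _.
rewrite mulrDl mul1r lerD2l mulrCA -[leRHS]mulr1 -mulrA ler_pM2l //.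
rewrite mulr1 (le_trans _ opt_ge1) // ler_pdivrMr ?ltr0n // mul1r.
by rewrite ler_nat.
Qed.

Lemma one_le_makespan (R : realType) (m n : nat) (P : 'I_n -> 'I_m -> R)
    (sigma : schedule m n) :
  (0 < m)%N -> (forall j i, 0 <= P j i) -> LB P [::] = 1 ->
  1 <= makespan P sigma.
Proof.
move=> m_gt0 P_ge0 <-; apply: (@LB_le_completion _ _ _ _ _ sigma) => // i.
by have := @promising_nil _ _ _ P 0 sigma i; rewrite mul0r addr0.
Qed.

Lemma promising_LB (R : realType) (m n : nat) (P : 'I_n -> 'I_m -> R)
    (eps : R) (sigma : schedule m n) (w : node m) :
  (0 < m)%N -> (0 < n)%N -> 0 < eps -> (forall j i, 0 <= P j i) ->
  LB P [::] = 1 -> (size w <= n)%N -> promising P eps sigma w ->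
  LB P w <= (1 + eps) * makespan P sigma.
Proof.
move=> m_gt0 n_gt0 eps_gt0 P_ge0 LB1 le_wn prom.
apply: (@LB_le_completion _ _ _ _ _ sigma) => // i.
by apply: promising_completion_le => //; exact: one_le_makespan.
Qed.

Lemma promising_not_too_long (R : realType) (m n : nat) (P : 'I_n -> 'I_m -> R)
    (eps : R) (sigma : schedule m n) (w : node m) :
  (0 < m)%N -> (0 < n)%N -> 0 < eps -> (forall j i, 0 <= P j i) ->
  LB P [::] = 1 -> makespan P sigma <= 2 -> (size w <= n)%N ->
  promising P eps sigma w ->
  \big[Num.max/0]_(i < m) profile P w i <= 2 * (1 + eps) ^+ 2.
Proof.
move=> m_gt0 n_gt0 eps_gt0 P_ge0 LB1 opt_le2 le_wn prom.
apply: bigmax_le => [|i _]; first by rewrite mulr_ge0 ?sqr_ge0.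
have opt_ge1 := one_le_makespan sigma m_gt0 P_ge0 LB1.
have := promising_completion_le i n_gt0 eps_gt0 opt_ge1 le_wn prom.
have : 0 <= \sum_(j < n | (size w <= j)%N && (sigma j == i)) P j i.
  exact: sumr_ge0.
by rewrite expr2; nra.
Qed.

(** The successor [w'] need not be a child of [w]: it may be the similar node that caused the child
    to be discarded. *)
Definition promising_survive (R : realType) (m n : nat) (P : 'I_n -> 'I_m -> R)
    (eps : R) (sigma : schedule m n) (st : state m n) : Prop :=
  forall w, w \in generated st -> promising P eps sigma w ->
    w \in active st \/
    exists2 w', w' \in generated st & size w' = (size w).+1 /\ promising P eps sigma w'.

(** Climb from the root through promising successors; as depths are at most [n], the climb ends at
    an active node. *)
Lemma ex_active_promising (R : realType) (m n : nat) (P : 'I_n -> 'I_m -> R)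
    (eps : R) (sigma : schedule m n) (k : nat) (st : state m n) :
  0 < eps -> run P eps k st -> promising_survive P eps sigma st ->
  exists w, [/\ w \in active st, (size w <= n)%N & promising P eps sigma w].
Proof.
move=> eps_gt0 /(run_invariant eps_gt0) [[_ g_size _ _] root _] surv.
suff climb d w : (n - size w = d)%N -> w \in generated st ->
    promising P eps sigma w ->
    exists w, [/\ w \in active st, (size w <= n)%N & promising P eps sigma w].
  exact: climb erefl root (promising_nil _ _ _).
elim: d w => [|d IHd] w sz gw prom.
  have [act|[w' gw' [sw' _]]] := surv w gw prom; first by exists w; rewrite g_size.
  by have := g_size _ gw'; rewrite sw' ltnNge -subn_eq0 sz.
have [act|[w' gw' [sw' prom']]] := surv w gw prom; first by exists w; rewrite g_size.
by apply: IHd prom' => //; rewrite sw' subnS sz.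
Qed.

Lemma run_near_optimal (R : realType) (m n : nat) (P : 'I_n -> 'I_m -> R)
    (eps : R) (sigma : schedule m n) (k : nat) (st : state m n) :
  (0 < m)%N -> (0 < n)%N -> 0 < eps -> (forall j i, 0 <= P j i) ->
  LB P [::] = 1 -> makespan P sigma <= 2 -> run P eps k st ->
  near_optimal_found P eps sigma st \/
  (~~ stopped st /\ promising_survive P eps sigma st).
Proof.
move=> m_gt0 n_gt0 eps_gt0 P_ge0 LB1 opt_le2; elim=> {k st} [|k st st' rn IH stp].
  right; split=> // w; rewrite inE => /eqP -> _; left; exact: eqxx.
have foundS : near_optimal_found P eps sigma st ->
    (forall tau, tau \in found st -> tau \in found st') ->
    near_optimal_found P eps sigma st' \/
    (~~ stopped st' /\ promising_survive P eps sigma st').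
  by move=> [tau ftau le_tau] sub; left; exists tau; rewrite ?sub.
have [dis _ [done _ [perm _ _ _]]] := run_invariant eps_gt0 rn.
case: stp foundS => {st'}.
  move=> v x0 tau not_term [act_v v_min] [lpx0 _] int rnd.
  move: IH => [found_st|[_ surv]] foundS.
    by apply: foundS => // tau' ftau' /=; rewrite in_cons ftau' orbT.
  have [w [act_w le_wn prom]] := ex_active_promising eps_gt0 rn surv.
  left; exists tau => /=; first exact: mem_head.
  (* Best-first selection compares [v] with the active promising node [w]: the rounded schedule
     costs at most [LB P v <= LB P w]. *)
  apply: (@le_trans _ _ (LB P v)).
    apply: rounding_integral_makespan rnd => //.
    exact: le_trans (LB_nil_ge0 m_gt0 P_ge0) (LB_nil_le v m_gt0 P_ge0).
  by apply: le_trans (v_min _ act_w) _; exact: promising_LB.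
move=> v x0 x tau not_term [act_v _] [lpx0 _] nint _ _.
have lt_vn := nonintegral_depth lpx0 nint.
pose j := Ordinal lt_vn; pose u := rcons v (sigma j).
rewrite /branch; set st1 := State _ _ _ _; set us := map _ _.
have := foldl_insert_child_discarded P st1 eps_gt0
  (map_f (rcons v) (mem_enum 'I_m (sigma j))).
rewrite -/us -/u; set st' := foldl _ _ _ => disc.
have [new [actE genE foundE stopE]] := foldl_insert_child_extends P eps us st1.
rewrite -/st' /= in actE genE foundE stopE.
move: IH => [found_st|[unstopped surv]] foundS.
  by apply: foundS => // tau' ftau' /=; rewrite foundE in_cons ftau' orbT.
have [near|not_near] := pselect (near_optimal_found P eps sigma st'); first by left.
right; rewrite stopE; split=> // w; rewrite genE mem_cat => /orP [new_w _|gw prom].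
  by left; rewrite actE mem_cat new_w.
have [act_w|[w' gw' next]] := surv w gw prom; last first.
  by right; exists w'; rewrite // mem_cat gw' orbT.
(* Only [v] leaves the active list, which is duplicate-free, so any other active node remains
   active. *)
have [eq_wv|ne] := eqVneq w v; last first.
  left; rewrite actE mem_cat mem_rem_uniq ?inE ?ne ?act_w ?orbT //.
  have [+ _ _ _] := dis; rewrite -(perm_uniq perm) cat_uniq.
  by case/and3P.
right; rewrite {w gw act_w}eq_wv in prom *.
have su : size u = (size v).+1 by rewrite size_rcons.
have prom_u : promising P eps sigma u.
  by apply: (promising_child (j := j) erefl prom) => //; exact: similar_profiles_refl.
(* Rejection by bound would mean a near-optimal schedule is known, rejection by length is
   impossible, and a similar node inherits the promise. *)
case: disc => [[tau' ftau' lt_LB]|too_long|[w gw [sw sim]]].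
- case: not_near; exists tau' => //; apply: (le_trans (ltW lt_LB)).
  by apply: promising_LB => //; rewrite su.
- move: too_long; rewrite ltNge (promising_not_too_long (sigma := sigma)) //.
  by rewrite su.
exists w; first by rewrite -genE.
by rewrite sw su; split=> //; apply: (promising_child (j := j) erefl prom); rewrite ?sw.
Qed.

(** If no near-optimal schedule was found, an active promising node bounds the least active [LB] by
    [(1 + eps)] times the makespan of [sigma]. Only the ratio test can then have ended the run, and
    it costs the second factor. *)
Lemma run_makespan_le (R : realType) (m n : nat) (P : 'I_n -> 'I_m -> R)
    (eps : R) (sigma tau : schedule m n) (k : nat) (st : state m n) :
  (0 < m)%N -> (0 < n)%N -> 0 < eps -> (forall j i, 0 <= P j i) ->
  LB P [::] = 1 -> makespan P sigma <= 2 -> run P eps k st ->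
  returns P eps st tau -> makespan P tau <= (1 + eps) ^+ 2 * makespan P sigma.
Proof.
move=> m_gt0 n_gt0 eps_gt0 P_ge0 LB1 opt_le2 rn [term [_ tau_min]].
have opt_ge1 := one_le_makespan sigma m_gt0 P_ge0 LB1.
have [[tau' ftau' near]|[unstopped surv]] :=
    run_near_optimal m_gt0 n_gt0 eps_gt0 P_ge0 LB1 opt_le2 rn.
  apply: le_trans (tau_min _ ftau') _; apply: le_trans near _.
  by rewrite ler_pM2r ?(lt_le_trans ltr01) // expr2; nra.
have [w [act_w le_wn prom]] := ex_active_promising eps_gt0 rn surv.
have LBw := promising_LB m_gt0 n_gt0 eps_gt0 P_ge0 LB1 le_wn prom.
case: term => [s|act0|[rho [v [[frho _] [_ v_min] ratio]]]].
- by rewrite s in unstopped.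
- by rewrite act0 in act_w.
have LBv_gt0 : 0 < LB P v.
  by apply: lt_le_trans (LB_nil_le v m_gt0 P_ge0); rewrite LB1.
rewrite ler_pdivrMr // in ratio.
apply: le_trans (tau_min _ frho) _; apply: le_trans ratio _.
rewrite expr2 -mulrA ler_pM2l ?(le_trans (v_min _ act_w)) //.
by rewrite addr_gt0.
Qed.

(** * Scaling, relabelling and the final guarantee *)

Lemma makespan_scale (R : realType) (m n : nat) (P Q : 'I_n -> 'I_m -> R) (c : R)
    (sigma : schedule m n) :
  0 <= c -> (forall j i, Q j i = c * P j i) ->
  makespan Q sigma = c * makespan P sigma.
Proof.
move=> c_ge0 QE; rewrite /makespan.
apply: (big_ind2 (fun a b => a = c * b)) => [|a b a' b' -> ->|i _].
- by rewrite mulr0.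
- by rewrite maxr_pMr.
by rewrite /completion mulr_sumr; apply: eq_bigr.
Qed.

Lemma makespan_original_labels (R : realType) (m n : nat) (p : 'I_n -> R)
    (s : 'I_m -> R) (lab : 'S_n) (sigma : schedule m n) :
  makespan (times p s) (original_labels lab sigma) =
  makespan (relabelled_times p s lab) sigma.
Proof.
apply: eq_bigr => i _; rewrite /completion (reindex_inj (@perm_inj _ lab)) /=.
by apply: eq_bigl => j; rewrite ffunE permK.
Qed.

Lemma opt_makespanP (R : realType) (m n : nat) (P : 'I_n -> 'I_m -> R) :
  (0 < m)%N -> exists sigma, opt_makespan P = makespan P sigma /\
    forall tau, makespan P sigma <= makespan P tau.
Proof.
move=> m_gt0; pose sigma0 : schedule m n := [ffun=> Ordinal m_gt0].
case: (@arg_minP _ _ _ sigma0 xpredT (makespan P) isT) => sigma _ min.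
exists sigma; split=> [|tau]; last exact: min.
apply: smallestP; first by exists sigma.
by move=> _ [tau _ <-]; exact: min.
Qed.

(** The bound on [k] holds in every reachable state and a state that has not terminated has a
    successor, so every run can be continued to termination within that many nodes. *)
Theorem theorem3 (R : realType) (m n : nat) (eps : R)
    (p : 'I_n -> R) (s : 'I_m -> R) (lab : 'S_n)
    (m_gt0 : (0 < m)%N) (n_gt0 : (0 < n)%N) (eps_gt0 : 0 < eps)
    (s_gt0 : forall i, 0 < s i)
    (times_nat : forall j i, times p s j i \is a Num.nat)
    (lab_sorted : forall j k : 'I_n, (j <= k)%N -> p (lab k) <= p (lab j)) :
  let P := normalized (relabelled_times p s lab) in
  forall (k : nat) (st : state m n), run P eps k st ->
  [/\ k%:R <= n%:R * (3 * n%:R * (1 + eps) ^+ 2 / eps) ^+ m,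
      ~ terminated P eps st -> exists st', step P eps st st',
      terminated P eps st -> exists sigma, returns P eps st sigma &
      forall sigma, returns P eps st sigma ->
        makespan (times p s) (original_labels lab sigma)
          <= (1 + eps) ^+ 2 * opt_makespan (times p s)].
Proof.
move=> P k st rn; set Q := relabelled_times p s lab in P rn *.
have Q_ge0 j i : 0 <= Q j i by exact: natr_ge0 (times_nat _ _).
have c_ge0 : 0 <= LB Q [::] by exact: LB_nil_ge0.
have P_ge0 j i : 0 <= P j i by rewrite divr_ge0.
split; [exact: run_node_bound rn | exact: run_progress | exact: run_returns rn |].
move=> tau ret; rewrite makespan_original_labels -/Q.
have [rho [-> rho_min]] := opt_makespanP (times p s) m_gt0.
pose sigma : schedule m n := [ffun j => rho (lab j)].
have rhoE : rho = original_labels lab sigma.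
  by apply/ffunP => j; rewrite !ffunE permKV.
rewrite rhoE makespan_original_labels -/Q.
(* If the root optimum is 0, each job has time 0 on some machine. As speeds are positive, all times
   and all makespans are then 0. *)
have [c0|c_neq0] := eqVneq (LB Q [::]) 0.
  have Q0 j i : Q j i = 0 * Q j i.
    have [i' le0] := LB_nil_eq0 j m_gt0 c0.
    have /eqP : Q j i' = 0 by apply/le_anti; rewrite le0 Q_ge0.
    rewrite mulf_eq0 invr_eq0 (gt_eqF (s_gt0 i')) orbF => /eqP p0.
    by rewrite mul0r /Q /relabelled_times /times p0 mul0r.
  have makespan0 rho' : makespan Q rho' = 0.
    by rewrite (makespan_scale _ (lexx 0) Q0) mul0r.
  by rewrite !makespan0 mulr0.
have c_gt0 : 0 < LB Q [::] by rewrite lt_def c_neq0.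
have LB1 : LB P [::] = 1 by exact: LB_nil_normalized.
have QE j i : Q j i = LB Q [::] * P j i by rewrite mulrC divfK.
rewrite !(makespan_scale _ c_ge0 QE) mulrCA ler_pM2l //.
apply: run_makespan_le rn ret => //.
(* Rounding a vertex at the root, where the bound is 1, gives a schedule of makespan at most 2; the
   optimal [sigma] is no worse. *)
have [x0 ver] := ex_vertex_smallest_feasible P
  (unfixed n ([::] : node m)) (profile P [::]) m_gt0.
have [sigma' rnd] := ex_rounding m_gt0 (ver : vertex (node_lp P [::]) x0).
apply: (@le_trans _ _ (makespan P sigma')).
  rewrite -(ler_pM2l c_gt0) -!(makespan_scale _ c_ge0 QE).
  by rewrite -!makespan_original_labels -rhoE; exact: rho_min.
have [lpx0 _] := ver.
by have := rounding_makespan_le2 P_ge0 _ lpx0 rnd; rewrite LB1 mulr1; apply.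
Qed.
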